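(* For all sufficiently large $n$, for $(G,\lambda)\sim\mathcal F_{n,1}$, with probability at least $1-2n^{-\sqrt{\log n}}$, for every vertex $v$ and every $k\in[n-1]$ we have $$\left|\hat Y^v_k-\sum_{i=1}^k\frac{1}{i(n-i)+1}\right|\le\frac{2(\log n)^{0.8}}{n}.$$
   Context: $\mathcal F_{n,1}$ is the random temporal graph on $n$ labelled vertices whose underlying graph $G$ is the complete graph $K_n$, where each edge receives an independent time label $\lambda(e)$ uniform in $[0,1]$. A temporal graph $(T,\lambda')$ with $T$ a tree is an increasing temporal tree rooted at $v$ if every vertex of $T$ is reachable from $v$ by a path in $T$ whose labels are non-decreasing. For a vertex $v$, run the following process: $T^v_0=(\{v\},\emptyset)$; for $k=1,\dots,n-1$, let $S^v_k$ be the set of edges of $G$ with exactly one endpoint in $V(T^v_{k-1})$, let $e^v_k$ be the edge $e\in S^v_k$ of minimum $\lambda(e)$ among those for which $T^v_{k-1}\cup\{e\}$ is an increasing temporal tree rooted at $v$, and set $T^v_k=T^v_{k-1}\cup\{e^v_k\}$. Define $Y^v_0=0$, $Y^v_k=\lambda(e^v_k)$, $X^v_k=Y^v_k-Y^v_{k-1}$ for $k\in[n-1]$. Let $c_k=\frac{2\log(\min\{k,n-k\})+\log\log n}{k(n-k)}$, $\hat X^v_k=\min\{X^v_k,c_k\}$ and $\hat Y^v_k=\sum_{i=1}^k\hat X^v_i$. $\log$ is the natural logarithm and $[m]=\{1,\dots,m\}$. *)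

(* Defs.v *)
From HB Require Import structures.
From mathcomp Require Import all_boot all_order all_algebra.
From mathcomp Require Import all_classical all_reals all_analysis.

Set Implicit Arguments.
Unset Strict Implicit.
Unset Printing Implicit Defensive.

Import Order.TTheory GRing.Theory Num.Theory.
Local Open Scope ring_scope.

(* Vertices are 'I_n; an edge is a two-element set of vertices.  A labelling is
   a total function on {set 'I_n}; its values off the edge set are never used. *)
Definition complete_graph (n : nat) : {set {set 'I_n}} :=
  [set e : {set 'I_n} | #|e| == 2%N].

Definition subgraph (n : nat) : Type := ({set 'I_n} * {set {set 'I_n}})%type.

Definition is_subgraph (n : nat) (T : subgraph n) : Prop :=
  forall e, e \in T.2 -> e \in complete_graph n /\ e \subset T.1.

Definition adj (n : nat) (T : subgraph n) : rel 'I_n :=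
  fun x y => [set x; y] \in T.2.

(* Nonempty, connected and acyclic.  A mathcomp [ucycle] may also be empty or
   traverse a single edge back and forth, hence the bound on its size. *)
Definition is_tree (n : nat) (T : subgraph n) : Prop :=
  [/\ is_subgraph T, T.1 != finset.set0,
      forall x y, x \in T.1 -> y \in T.1 -> connect (adj T) x y
    & forall c : seq 'I_n, ucycle (adj T) c -> (size c <= 2)%N].

Definition path_labels (R : realType) (n : nat) (lam : {set 'I_n} -> R)
    (v : 'I_n) (p : seq 'I_n) : seq R :=
  pairmap (fun x y => lam [set x; y]) v p.

Definition reachable (R : realType) (n : nat) (lam : {set 'I_n} -> R)
    (T : subgraph n) (v u : 'I_n) : Prop :=
  exists p : seq 'I_n,
    [/\ path (adj T) v p, uniq (v :: p), last v p = u
      & sorted (fun a b : R => a <= b) (path_labels lam v p)].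

Definition increasing_tree (R : realType) (n : nat) (lam : {set 'I_n} -> R)
    (v : 'I_n) (T : subgraph n) : Prop :=
  [/\ is_tree T, v \in T.1 & forall u, u \in T.1 -> reachable lam T v u].

Definition add_edge (n : nat) (T : subgraph n) (e : {set 'I_n}) : subgraph n :=
  (T.1 :|: e, e |: T.2).

Definition boundary (n : nat) (G : {set {set 'I_n}}) (V : {set 'I_n}) :
    {set {set 'I_n}} :=
  [set e in G | #|e :&: V| == 1%N].

Definition admissible (R : realType) (n : nat) (G : {set {set 'I_n}})
    (lam : {set 'I_n} -> R) (v : 'I_n) (T : subgraph n) : {set {set 'I_n}} :=
  [set e in boundary G T.1 | `[< increasing_tree lam v (add_edge T e) >]].

(* Ties are broken by the enumeration order of edges; when the labels are
   continuous and independent, ties have probability zero.  The value is [None]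
   only if no edge is admissible, which cannot happen on the complete graph
   before all vertices are reached. *)
Definition next_edge (R : realType) (n : nat) (G : {set {set 'I_n}})
    (lam : {set 'I_n} -> R) (v : 'I_n) (T : subgraph n) : option {set 'I_n} :=
  [pick e in admissible G lam v T
    | [forall f in admissible G lam v T, lam e <= lam f]].

Fixpoint process_tree (R : realType) (n : nat) (G : {set {set 'I_n}})
    (lam : {set 'I_n} -> R) (v : 'I_n) (k : nat) : subgraph n :=
  if k is j.+1 then
    let T := process_tree G lam v j in
    if next_edge G lam v T is Some e then add_edge T e else T
  else ([set v], finset.set0).

Definition Y (R : realType) (n : nat) (G : {set {set 'I_n}})
    (lam : {set 'I_n} -> R) (v : 'I_n) (k : nat) : R :=
  if k is j.+1 then
    oapp lam 0 (next_edge G lam v (process_tree G lam v j))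
  else 0.

Definition X (R : realType) (n : nat) (G : {set {set 'I_n}})
    (lam : {set 'I_n} -> R) (v : 'I_n) (k : nat) : R :=
  Y G lam v k - Y G lam v k.-1.

Definition cutoff (R : realType) (n k : nat) : R :=
  (2 * ln (minn k (n - k))%:R + ln (ln n%:R)) / (k * (n - k))%:R.

Definition Xhat (R : realType) (n : nat) (G : {set {set 'I_n}})
    (lam : {set 'I_n} -> R) (v : 'I_n) (k : nat) : R :=
  Num.min (X G lam v k) (cutoff R n k).

Definition Yhat (R : realType) (n : nat) (G : {set {set 'I_n}})
    (lam : {set 'I_n} -> R) (v : 'I_n) (k : nat) : R :=
  \sum_(1 <= i < k.+1) Xhat G lam v i.

Definition mutually_independent (d : measure_display) (Omega : measurableType d)
    (R : realType) (P : probability Omega R) (I : finType) (A : {set I})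
    (Z : I -> {RV P >-> R}) : Prop :=
  forall (J : {set I}) (B : I -> set R),
    J \subset A -> (forall i, i \in J -> measurable (B i)) ->
    P [set w | forall i, i \in J -> B i (Z i w)]%classic =
    (\prod_(i in J) P (Z i @^-1` B i)%classic)%E.

(* The labels of the random temporal graph F_{n,1}: independent and uniform on
   [0,1], one for each edge of the complete graph. *)
Definition uniform_labels (d : measure_display) (Omega : measurableType d)
    (R : realType) (P : probability Omega R) (n : nat)
    (lam : {set 'I_n} -> {RV P >-> R}) : Prop :=
  (forall e, e \in complete_graph n -> forall B : set R, measurable B ->
     distribution P (lam e) B = uniform_prob (@ltr01 R) B) /\
  mutually_independent (complete_graph n) lam.

(* Main.v *)
(** Discretisation reduces the claim to counting.  Cut [0,1] into [M] equal cells
   and record only the cell of each label; breaking ties by a fixed numbering of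
   the edges gives distinct integer labels.  The process depends only on the order
   of the labels, so it is the same for both labellings unless two labels share a
   cell, and this has probability [O(1/M)].

   On the finite grid, fix a root and let [T_k], [Y_k] be the tree and the time
   after [k] steps.  The labels of the [N = (k+1)(n-k-1)] boundary edges can be
   resampled freely outside the window from the arrival time of their endpoint to
   [Y_k] without changing the first [k] steps.  So, given these steps, the
   probability that the next increment exceeds [x] is a product of [N] factors, at
   most [(1-x)^N], and at least [(1-x/(1-delta))^N] while [Y_k <= delta].  The
   truncated increment then has conditional mean at most [1/(N+1)], and at least
   that up to a small bias.  The inequality [exp x <= x + exp (2 x^2)] turns this
   into sub-Gaussian exponential moments with variance proxy the squared cutoffs,
   whose sum is [O((log log n / n)^2)]; this beats [n^(-sqrt (log n))] at deviation
   [(log n)^0.8 / n].  The bias needs [Y] to stay small, which holds because no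
   increment exceeds [(log n)^2 / N], up to a negligible probability. *)

Require Import Defs.
From HB Require Import structures.
From mathcomp Require Import all_boot all_order all_algebra.
From mathcomp Require Import all_classical all_reals all_analysis.
From mathcomp Require Import zify ring lra.

Set Implicit Arguments.
Unset Strict Implicit.
Unset Printing Implicit Defensive.

Import Order.TTheory GRing.Theory Num.Theory.
Local Open Scope ring_scope.

(** * Leaf extensions of increasing trees *)

Section LeafExtension.
Variables (n : nat) (T : subgraph n) (u w : 'I_n).
Hypotheses (Tsub : is_subgraph T) (uT : u \in T.1) (wT : w \notin T.1).
Let T' := add_edge T [set u; w].

Lemma adj_sym (S : subgraph n) : symmetric (adj S).
Proof. by move=> x y; rewrite /adj finset.setUC. Qed.

Lemma neq_leaf : u != w.
Proof. by apply: contraNneq wT => <-. Qed.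

Lemma add_leafE x y : adj T' x y = ([set x; y] == [set u; w]) || adj T x y.
Proof. by rewrite /adj /T' /= !inE. Qed.

Lemma adj_vertex x y : adj T x y -> x \in T.1 /\ y \in T.1.
Proof.
by move=> /Tsub [_ /fintype.subsetP s]; split; apply: s; rewrite !inE eqxx ?orbT.
Qed.

Lemma path_vertices x p : x \in T.1 -> path (adj T) x p ->
  {subset x :: p <= T.1}.
Proof.
elim: p x => [|y p IH] x xT /=; first by move=> _ t; rewrite inE => /eqP->.
move=> /andP[xy yp] t; rewrite inE => /orP[/eqP->//|].
by apply: IH yp _; have [] := adj_vertex xy.
Qed.

Lemma mem_add_leaf x : (x \in T'.1) = (x == w) || (x \in T.1).
Proof.
rewrite /T' /= !inE; case: (x =P u) => [->|_]; first by rewrite uT /= orbT.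
by rewrite orbC.
Qed.

Lemma adj_leaf x : adj T' x w = (x == u).
Proof.
rewrite add_leafE; apply/orP/eqP => [[/eqP e|/adj_vertex[_]]|->].
- have : u \in [set x; w] by rewrite e !inE eqxx.
  by rewrite !inE (negPf neq_leaf) orbF => /eqP.
- by rewrite (negPf wT).
- by left.
Qed.

Lemma adj_nonleaf x y : x != w -> y != w -> adj T' x y = adj T x y.
Proof.
move=> xw yw; rewrite add_leafE; case: eqP => //= e.
have : w \in [set x; y] by rewrite e !inE eqxx orbT.
by rewrite !inE ![w == _]eq_sym (negPf xw) (negPf yw).
Qed.

Lemma path_nonleaf x p : w \notin x :: p -> path (adj T') x p = path (adj T) x p.
Proof.
elim: p x => //= y p IH x; rewrite !inE !negb_or => /and3P[xw yw wp].
by rewrite adj_nonleaf 1?eq_sym // IH // inE negb_or yw.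
Qed.

(** The only neighbour of [w] is [u], so a simple path with [w] in its interior would visit [u] on
    both sides of it. *)
Lemma path_avoid_leaf x p : x \in T.1 -> path (adj T') x p -> uniq (x :: p) ->
  last x p != w -> w \notin x :: p.
Proof.
move=> xT pp up lw; rewrite inE negb_or; apply/andP; split.
  by apply: contraNneq wT => ->.
apply/negP => wp; case/splitPr: wp pp up lw => p1 p2 pp.
rewrite -cat_cons cat_uniq => /and3P[_ /hasPn h _].
move: pp; rewrite cat_path /= adj_leaf => /and3P[_ /eqP lu].
case: p2 h => [|y p2] h; first by rewrite last_cat /= eqxx.
move=> /= /andP[]; rewrite adj_sym adj_leaf => /eqP yu _ _.
have /h : u \in [:: w, y & p2] by rewrite yu !inE eqxx orbT.
by rewrite /= -{1}lu mem_last.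
Qed.

Lemma add_leaf_tree : is_tree T -> is_tree T'.
Proof.
move=> [_ T0 Tc Ta]; split.
- move=> e; rewrite /T' /= !inE => /orP[/eqP->|/Tsub[]].
    rewrite cards2 neq_leaf; split => //.
    by apply: finset.subsetUr.
  rewrite inE => -> s; split => //.
  by apply: fintype.subset_trans s _; apply: finset.subsetUl.
- by apply/set0Pn; exists u; rewrite mem_add_leaf uT orbT.
- have sub x y : adj T x y -> adj T' x y by rewrite add_leafE => ->; rewrite orbT.
  have csub x y : connect (adj T) x y -> connect (adj T') x y.
    by apply: connect_sub => a b /sub; apply: connect1.
  have uw : connect (adj T') u w by apply: connect1; rewrite adj_leaf.
  have wu : connect (adj T') w u.
    by apply: connect1; rewrite adj_sym adj_leaf.
  move=> x y; rewrite !mem_add_leaf => /orP[/eqP->|xT] /orP[/eqP->|yT] //.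
  + by apply: connect_trans wu (csub _ _ (Tc _ _ uT yT)).
  + by apply: connect_trans (csub _ _ (Tc _ _ xT uT)) uw.
  + exact: csub (Tc _ _ xT yT).
- move=> c uc; case wc: (w \in c); last first.
    apply: Ta; move: uc wc; rewrite /ucycle; case: c => [|x p] //= /andP[cp ->].
    rewrite andbT => wc.
    by rewrite path_nonleaf // in cp; rewrite -rcons_cons mem_rcons inE wc
      orbF; move/negbT: wc; rewrite inE negb_or => /andP[].
  (* A cycle through [w] is rotated to start there. Its second and its last vertex are both the
     unique neighbour [u], so its size is at most two. *)
  case/rot_to: wc => i p cE.
  have : ucycle (adj T') (w :: p) by rewrite -cE /ucycle rot_cycle rot_uniq.
  rewrite -(size_rot i) cE; case: p {cE} => [//|y p] /andP[] /=.
  rewrite rcons_path adj_sym adj_leaf => /and3P[/eqP-> _].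
  rewrite adj_leaf => /eqP lu; case: p lu => //= z p lu /and3P[_ + _].
  by rewrite -{1}lu mem_last.
Qed.

End LeafExtension.

(** * Arrival times in increasing trees *)

Lemma sorted_rcons_le (R : realType) (s : seq R) (x : R) :
  sorted (fun a b : R => a <= b) (rcons s x) =
  sorted (fun a b : R => a <= b) s && ((s == [::]) || (last 0 s <= x)).
Proof. by case: s => //= y s; rewrite rcons_path. Qed.

Lemma path_labels_rcons (R : realType) n (lam : {set 'I_n} -> R) v p w :
  path_labels lam v (rcons p w) =
  rcons (path_labels lam v p) (lam [set last v p; w]).
Proof. by rewrite /path_labels -cats1 pairmap_cat cats1. Qed.

(* [a u] is the label of the last edge of the tree path from the root to [u],
   with value [0] at the root. *)
Definition arrival_tree (R : realType) n (lam : {set 'I_n} -> R) v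
    (T : subgraph n) (a : 'I_n -> R) : Prop :=
  [/\ is_tree T, v \in T.1,
      forall u, u \in T.1 -> exists p,
        [/\ path (adj T) v p, uniq (v :: p), last v p = u,
            sorted (fun x y : R => x <= y) (path_labels lam v p)
          & last 0 (path_labels lam v p) = a u]
    & forall u p, path (adj T) v p -> uniq (v :: p) -> last v p = u ->
        sorted (fun x y : R => x <= y) (path_labels lam v p) ->
        a u <= last 0 (path_labels lam v p)].

Section ArrivalTree.
Variables (R : realType) (n : nat) (lam : {set 'I_n} -> R) (v : 'I_n).
Hypothesis lam_ge0 : forall e, 0 <= lam e.
Implicit Types (T : subgraph n) (a : 'I_n -> R).

Lemma uniq_last_root p : uniq (v :: p) -> last v p = v -> p = [::].
Proof. by case: p => //= x p /andP[vp _] lv; move: vp; rewrite -{1}lv mem_last. Qed.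

Lemma arrival_root T a : arrival_tree lam v T a -> a v = 0.
Proof.
by move=> [_ vT ex _]; have [p [_ up lp _ <-]] := ex _ vT; rewrite (uniq_last_root up lp).
Qed.

Lemma arrival_increasing T a : arrival_tree lam v T a -> increasing_tree lam v T.
Proof. by move=> [tT vT ex _]; split => // u /ex[p [? ? ? ? _]]; exists p. Qed.

Lemma arrival_add_leaf T a u w : arrival_tree lam v T a -> u \in T.1 ->
  w \notin T.1 -> a u <= lam [set u; w] ->
  arrival_tree lam v (add_edge T [set u; w])
    (fun x => if x \in T.1 then a x else lam [set u; w]).
Proof.
move=> aT uT wT au; have [tT vT ex mn] := aT; have [sT _ _ _] := tT.
have vw : v != w by apply: contraNneq wT => <-.
split.
- exact: add_leaf_tree.
- by rewrite mem_add_leaf // vT orbT.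
- move=> x; rewrite mem_add_leaf // => /orP[/eqP->|xT].
    rewrite (negPf wT); have [p [pp up lp sp la]] := ex _ uT.
    have wp : w \notin v :: p.
      by apply/negP => /(path_vertices sT vT pp); apply/negP.
    exists (rcons p w); split=> [||||].
    + by rewrite rcons_path path_nonleaf // pp lp adj_leaf ?eqxx.
    + by rewrite -rcons_cons rcons_uniq wp up.
    + by rewrite last_rcons.
    + by rewrite path_labels_rcons sorted_rcons_le sp la lp au orbT.
    + by rewrite path_labels_rcons last_rcons lp.
  have [p [pp up lp sp la]] := ex _ xT; exists p; split => //; last by rewrite xT.
  by apply: sub_path pp => s t; rewrite add_leafE => ->; rewrite orbT.
- move=> x p pp up lp sp; case xT: (x \in T.1).
    have xw : last v p != w by rewrite lp; apply: contraTneq xT => ->.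
    have av := path_avoid_leaf sT uT wT vT pp up xw.
    by apply: mn => //; rewrite -(path_nonleaf T u av).
  case: (lastP p) pp up lp sp => [_ _ /= vx|q y]; first by rewrite -vx vT in xT.
  rewrite rcons_path last_rcons => /andP[_ qy] _ yx _.
  rewrite path_labels_rcons last_rcons.
  suff /eqP-> : [set last v q; y] == [set u; w] by [].
  by move: qy; rewrite add_leafE => /orP[//|/(adj_vertex sT)[_]]; rewrite yx xT.
Qed.

(** Admissibility becomes a comparison of two numbers. For the forward direction, an increasing path
    to [w] is an increasing path to [u] followed by the new edge, and the minimality clause of
    [arrival_tree] bounds [a u] by the last label of that prefix. *)
Lemma arrival_add_leafP T a u w : arrival_tree lam v T a -> u \in T.1 ->
  w \notin T.1 ->
  increasing_tree lam v (add_edge T [set u; w]) <-> a u <= lam [set u; w].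
Proof.
move=> aT uT wT; split; last first.
  by move=> au; apply: arrival_increasing (arrival_add_leaf aT uT wT au).
have [tT vT ex mn] := aT; have [sT _ _ _] := tT.
move=> [_ _ /(_ w)]; rewrite mem_add_leaf // eqxx => /(_ isT) [p [pp up lp sp]].
case: (lastP p) pp up lp sp => [_ _ /= vw|q y]; first by rewrite -vw vT in wT.
rewrite rcons_path last_rcons path_labels_rcons sorted_rcons_le.
rewrite -rcons_cons rcons_uniq => /andP[pq qy] /andP[yq uq] yw /andP[sq].
subst y; move: qy; rewrite adj_leaf // => /eqP lq; rewrite lq.
have av : w \notin v :: q by [].
have pT : path (adj T) v q by rewrite -(path_nonleaf T u av).
have := mn _ _ pT uq lq sq.
(* An empty prefix means [u = v], which arrives at time [0]; here nonnegativity of the labels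
   suffices. *)
case: q lq {pq yq uq sq av pT} => [/= <- _ _|z q _ le1 /= le2].
  by rewrite (arrival_root aT).
exact: le_trans le1 le2.
Qed.

End ArrivalTree.

(** * The process and its histories *)

Section Boundary.
Variables (n : nat) (V : {set 'I_n}).

Lemma boundaryP e : reflect
  (exists u w, [/\ u \in V, w \notin V & e = [set u; w]])
  (e \in boundary (complete_graph n) V).
Proof.
rewrite !inE; apply: (iffP andP) => [[/cards2P[x [y [xy ->]]]]|[u [w [uV wV ->]]]].
  case xV: (x \in V); case yV: (y \in V).
  - have -> : [set x; y] :&: V = [set x; y].
      by apply/finset.setIidPl; rewrite finset.subUset !finset.sub1set xV yV.
    by rewrite cards2 xy.
  - by exists x, y; rewrite xV yV.
  - by exists y, x; rewrite xV yV finset.setUC.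
  - have -> : [set x; y] :&: V = finset.set0; last by rewrite cards0.
    apply/setP => z; rewrite !inE; apply/andP => -[/orP[]/eqP->];
    by rewrite ?xV ?yV.
have uw : u != w by apply: contraNneq wV => <-.
split; first by rewrite cards2 uw.
apply/cards1P; exists u; apply/setP => z; rewrite !inE.
have [->|zu] /= := eqVneq z u; first by rewrite uV.
by have [->|] := eqVneq z w; rewrite ?(negPf wV).
Qed.

Lemma edge_setI u w : u \in V -> w \notin V -> [set u; w] :&: V = [set u].
Proof.
move=> uV wV; apply/setP => z; rewrite !inE.
have [->|zu] /= := eqVneq z u; first by rewrite uV.
by have [->|] := eqVneq z w; rewrite ?(negPf wV).
Qed.

Lemma card_boundary : #|boundary (complete_graph n) V| = (#|V| * (n - #|V|))%N.
Proof.
have -> : boundary (complete_graph n) V =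
    [set [set p.1; p.2] | p in finset.setX V (~: V)].
  apply/setP => e; apply/boundaryP/imsetP => [[u [w [uV wV ->]]]|].
    by exists (u, w) => //; rewrite !inE uV.
  by move=> [[u w]]; rewrite !inE /= => /andP[uV wV] ->; exists u, w.
rewrite card_in_imset; first by rewrite cardsX [#|~: V|]cardsCs finset.setCK card_ord.
move=> [u w] [u' w']; rewrite !inE /= => /andP[uV wV] /andP[uV' wV'] e.
have /set1_inj uu : [set u] = [set u'] by rewrite -(edge_setI uV wV) e edge_setI.
have : w \in [set u'; w'] by rewrite -e !inE eqxx orbT.
rewrite -uu !inE => /orP[/eqP wu|/eqP->//].
by rewrite wu uV in wV.
Qed.

End Boundary.

Section Process.
Variables (R : realType) (n : nat).
Local Notation E := (complete_graph n).

(** A vertex not yet reached gets the current time as a default value, so that [arrival_le] holds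
    without a membership hypothesis. *)
Fixpoint arrival (lam : {set 'I_n} -> R) (v : 'I_n) (k : nat) (u : 'I_n) : R :=
  if k is j.+1 then
    if u \in (process_tree E lam v j).1 then arrival lam v j u
    else Y E lam v j.+1
  else 0.

(* For a boundary edge [e] the sum has one term: the arrival time of the
   endpoint of [e] lying in the current tree. *)
Definition edge_arrival lam v k (e : {set 'I_n}) : R :=
  \sum_(u in e :&: (process_tree E lam v k).1) arrival lam v k u.

Lemma next_edge_some (lam : {set 'I_n} -> R) v T e0 :
  e0 \in admissible E lam v T ->
  exists e, [/\ next_edge E lam v T = Some e, e \in admissible E lam v T
    & forall f, f \in admissible E lam v T -> lam e <= lam f].
Proof.
move=> e0T; rewrite /next_edge; case: pickP => [e /andP[eT /forall_inP me]|none].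
  by exists e.
case: (Order.TotalTheory.arg_minP lam e0T) => e eT me.
by have /negP[] := negbT (none e); apply/andP; split => //; apply/forall_inP.
Qed.

Section Fixed.
Variables (lam : {set 'I_n} -> R) (v : 'I_n).
Hypotheses (lam_gt0 : forall e, 0 < lam e) (lam_inj : injective lam).
Local Notation st k := (process_tree E lam v k).
Local Notation nx k := (next_edge E lam v (process_tree E lam v k)).
Local Notation Yv k := (Y E lam v k).

Let lam_ge0 e : 0 <= lam e. Proof. exact: ltW. Qed.

Lemma arrival_tree0 : arrival_tree lam v (st 0) (arrival lam v 0).
Proof.
have nadj x y : adj (st 0) x y = false by rewrite /adj inE.
split => /=.
- split => /=.
  + by move=> e; rewrite inE.
  + by apply/set0Pn; exists v; rewrite inE.
  + by move=> x y; rewrite !inE => /eqP-> /eqP->.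
  + case=> [//|x p] /andP[]; case: p => [|y p] //=.
    by rewrite nadj.
- by rewrite inE.
- by move=> u; rewrite inE => /eqP->; exists [::].
- by move=> u [|x p] //=; rewrite nadj.
Qed.

Lemma mem_admissible k u w : arrival_tree lam v (st k) (arrival lam v k) ->
  u \in (st k).1 -> w \notin (st k).1 ->
  ([set u; w] \in admissible E lam v (st k)) = (arrival lam v k u <= lam [set u; w]).
Proof.
move=> aT uT wT; rewrite inE.
have -> /= : [set u; w] \in boundary E (st k).1 by apply/boundaryP; exists u, w.
by apply/asboolP/idP => /(arrival_add_leafP lam_ge0 aT uT wT).
Qed.

Lemma process_step k : (k.+1 < n)%N ->
  arrival_tree lam v (st k) (arrival lam v k) -> #|(st k).1| = k.+1 ->
  exists u w, [/\ nx k = Some [set u; w], u \in (st k).1, w \notin (st k).1,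
    arrival lam v k u <= lam [set u; w] &
    forall f, f \in admissible E lam v (st k) -> lam [set u; w] <= lam f].
Proof.
move=> kn aT cT; have [_ vT _ _] := aT.
have [w0 w0T] : exists w, w \notin (st k).1.
  apply/existsP; rewrite -negb_forall; apply/negP => /forallP h.
  have : (n <= k.+1)%N by rewrite -cT -[X in (X <= _)%N]card_ord; apply/subset_leq_card/fintype.subsetP.
  by rewrite leqNgt kn.
(* [next_edge] is not [None] here: every edge from the root to an unreached vertex is admissible,
   because the root arrives at time [0]. *)
have e0 : [set v; w0] \in admissible E lam v (st k).
  by rewrite mem_admissible // (arrival_root aT).
have [e [ne eT me]] := next_edge_some e0.
have /boundaryP[u [w [uT wT eE]]] : e \in boundary E (st k).1.
  by move: eT; rewrite inE => /andP[].
by exists u, w; rewrite -eE; split => //; move: eT; rewrite eE mem_admissible.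
Qed.

Lemma process_inv k : (k < n)%N ->
  arrival_tree lam v (st k) (arrival lam v k) /\ #|(st k).1| = k.+1.
Proof.
elim: k => [_|k IH kn]; first by split; [exact: arrival_tree0|rewrite cards1].
have [aT cT] := IH (ltnW kn).
have [u [w [ne uT wT au _]]] := process_step kn aT cT.
have stE : st k.+1 = add_edge (st k) [set u; w] by rewrite /= ne.
split; last first.
  rewrite stE; have -> : (add_edge (st k) [set u; w]).1 = w |: (st k).1.
    by apply/setP => x; rewrite mem_add_leaf // !inE.
  by rewrite cardsU1 wT cT.
rewrite stE; have := arrival_add_leaf aT uT wT au.
by rewrite -[lam _]/(oapp lam 0 (Some [set u; w])) -ne.
Qed.

Lemma process_tree_subset j k : (j <= k)%N -> (st j).1 \subset (st k).1.
Proof.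
elim: k => [|k IH]; first by rewrite leqn0 => /eqP->.
rewrite leq_eqVlt ltnS => /orP[/eqP->//|/IH s]; apply: (fintype.subset_trans s).
by rewrite /=; case: (nx k) => //= e; apply: finset.subsetUl.
Qed.

Lemma arrival_stable j k u : (j <= k)%N -> u \in (st j).1 ->
  arrival lam v k u = arrival lam v j u.
Proof.
elim: k => [|k IH]; first by rewrite leqn0 => /eqP->.
rewrite leq_eqVlt ltnS => /orP[/eqP->//|jk] uT.
by rewrite /= (fintype.subsetP (process_tree_subset jk)) // IH.
Qed.

Lemma edge_arrivalE k u w : u \in (st k).1 -> w \notin (st k).1 ->
  edge_arrival lam v k [set u; w] = arrival lam v k u.
Proof. by move=> uT wT; rewrite /edge_arrival edge_setI // big_set1. Qed.

Lemma next_edgeP k : (k.+1 < n)%N -> exists u w,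
  [/\ nx k = Some [set u; w], Yv k.+1 = lam [set u; w],
      u \in (st k).1 /\ w \notin (st k).1,
      [set u; w] \subset (st k.+1).1 &
      arrival lam v k u <= lam [set u; w] /\
      forall x y, x \in (st k).1 -> y \notin (st k).1 ->
        arrival lam v k x <= lam [set x; y] -> lam [set u; w] <= lam [set x; y]].
Proof.
move=> kn; have [aT cT] := process_inv (ltnW kn).
have [u [w [ne uT wT au me]]] := process_step kn aT cT.
exists u, w; split => //=; rewrite ?ne //=; first exact: finset.subsetUr.
by split => // x y xT yT axy; apply: me; rewrite mem_admissible.
Qed.

(** If the label is not below the arrival of the endpoint, then either the edge was a candidate in
    the last step and lost, or its endpoint arrived in that very step. Injectivity of the labels
    makes the inequality with [Y] strict. *)
Lemma boundary_label k e : (k < n)%N -> e \in boundary E (st k).1 ->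
  lam e < edge_arrival lam v k e \/ Yv k < lam e.
Proof.
case: k => [|k] kn /boundaryP[u [w [uT wT ->]]]; first by right; exact: lam_gt0.
rewrite edge_arrivalE //.
have [u' [w' [_ YE _ sT' [_ me]]]] := next_edgeP kn.
have ne : lam [set u'; w'] != lam [set u; w].
  apply: contra wT => /eqP/lam_inj ee; apply: (fintype.subsetP sT').
  by rewrite ee !inE eqxx orbT.
rewrite YE; have [lt|le] := ltP (lam [set u; w]) (arrival lam v k.+1 u).
  by left.
right; rewrite lt_neqAle ne /=; move: le => /=.
have wk : w \notin (st k).1.
  by apply: contra wT; apply: (fintype.subsetP (process_tree_subset (leqnSn k))).
by case: ifP => uk; [exact: me|rewrite -YE].
Qed.

Lemma Y_ltS k : (k.+1 < n)%N -> Yv k < Yv k.+1.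
Proof.
move=> kn; have [u [w [_ -> [uT wT] _ [au _]]]] := next_edgeP kn.
have eB : [set u; w] \in boundary E (st k).1 by apply/boundaryP; exists u, w.
case: (boundary_label (ltnW kn) eB) => //.
by rewrite edge_arrivalE // ltNge au.
Qed.

Lemma Y_homo j k : (j <= k)%N -> (k < n)%N -> Yv j <= Yv k.
Proof.
elim: k => [|k IH]; first by rewrite leqn0 => /eqP->.
rewrite leq_eqVlt ltnS => /orP[/eqP->//|jk] kn.
by apply: le_trans (IH jk (ltnW kn)) (ltW (Y_ltS kn)).
Qed.

Lemma arrival_le k u : (k < n)%N -> arrival lam v k u <= Yv k.
Proof.
elim: k => [//|k IH kn] /=; case: ifP => // _.
exact: le_trans (IH (ltnW kn)) (ltW (Y_ltS kn)).
Qed.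

Lemma edge_arrival_le k e : (k < n)%N -> e \in boundary E (st k).1 ->
  edge_arrival lam v k e <= Yv k.
Proof.
by move=> kn /boundaryP[u [w [uT wT ->]]]; rewrite edge_arrivalE // arrival_le.
Qed.

(** A tail event of the next step is a condition on each boundary edge separately, hence a product
    set on the grid. *)
Lemma lt_Y k z : (k.+1 < n)%N ->
  (z < Yv k.+1) = [forall e in boundary E (st k).1,
    (lam e < edge_arrival lam v k e) || (z < lam e)].
Proof.
move=> kn; have [u [w [_ -> [uT wT] _ [au me]]]] := next_edgeP kn.
apply/idP/forall_inP => [zY e /boundaryP[x [y [xT yT ->]]]|h].
  rewrite edge_arrivalE //; case: (ltP _ (arrival lam v k x)) => //= axy.
  exact: lt_le_trans zY (me _ _ xT yT axy).
have /h : [set u; w] \in boundary E (st k).1 by apply/boundaryP; exists u, w.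
by rewrite edge_arrivalE // ltNge au.
Qed.

End Fixed.

(* The labels of the boundary edges of the [k]-th tree are only constrained, by
   the first [k] steps, to avoid the interval between the arrival of their
   endpoint and the current time. *)
Lemma process_resample (lam lam' : {set 'I_n} -> R) v k : (k < n)%N ->
  (forall e, 0 < lam e) -> injective lam ->
  (forall e, 0 < lam' e) -> injective lam' ->
  (forall e, e \notin boundary E (process_tree E lam v k).1 -> lam' e = lam e) ->
  (forall e, e \in boundary E (process_tree E lam v k).1 ->
     lam' e < edge_arrival lam v k e \/ Y E lam v k < lam' e) ->
  forall j, (j <= k)%N ->
    [/\ process_tree E lam' v j = process_tree E lam v j,
        Y E lam' v j = Y E lam v j & arrival lam' v j = arrival lam v j].
Proof.
move=> kn p0 pI p0' pI' off on; elim=> [//|j IH] jk.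
have [sE yE aE] := IH (ltnW jk).
have jn : (j.+1 < n)%N by apply: leq_ltn_trans kn.
have [u [w [ne YE [uT wT] eT [au me]]]] := next_edgeP v p0 jn.
have [u' [w' [ne' YE' + _]]] := next_edgeP v p0' jn.
rewrite sE aE => -[uT' wT'] [au' me'].
(* An edge chosen during the first [k] steps has both endpoints in the [k]-th tree, so it is not
   resampled. *)
have eb : lam' [set u; w] = lam [set u; w].
  apply: off; apply/negP => /boundaryP[x [y [_ yT xy]]]; move/negP: yT; apply.
  apply: (fintype.subsetP (process_tree_subset lam v jk)).
  by apply: (fintype.subsetP eT); rewrite xy !inE eqxx orbT.
have le1 : lam' [set u'; w'] <= lam [set u; w].
  by rewrite -eb; apply: me' => //; rewrite eb.
have ee : [set u'; w'] = [set u; w].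
  apply: pI'; apply/eqP; rewrite eq_le eb le1 /=.
  (* If the new choice were a boundary edge of the [k]-th tree, its resampled label would either
     precede the arrival of its endpoint, making it inadmissible, or exceed [Y] at [k], making it
     too late. *)
  have [eB|eB] := boolP ([set u'; w'] \in boundary E (process_tree E lam v k).1).
    have uk : u' \in (process_tree E lam v k).1.
      exact: (fintype.subsetP (process_tree_subset lam v (ltnW jk))).
    have wk : w' \notin (process_tree E lam v k).1.
      have /boundaryP[x [y [xT yT xy]]] := eB; rewrite xy in eB.
      have : y \in [set u'; w'] by rewrite xy !inE eqxx orbT.
      by rewrite !inE => /orP[/eqP yu|/eqP<-//]; rewrite yu uk in yT.
    case: (on _ eB) => [|Yl].
      by rewrite edge_arrivalE // (arrival_stable (ltnW jk)) // ltNge au'.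
    have := lt_le_trans Yl le1; rewrite -YE ltNge.
    by rewrite (Y_homo v p0 pI jk kn).
  by rewrite off // me // -off.
have nn : next_edge E lam' v (process_tree E lam v j) =
  next_edge E lam v (process_tree E lam v j) by rewrite -{1}sE ne' ne ee.
split.
- by rewrite /= sE nn.
- by rewrite YE' YE ee eb.
- by apply/funext => x; rewrite /= sE aE nn ne /= eb.
Qed.

(** * Dependence of the process on the order of the labels alone *)

Section OrderInvariance.
Variables lam lam' : {set 'I_n} -> R.
Hypothesis same : forall e f, e \in E -> f \in E ->
  (lam e <= lam f) = (lam' e <= lam' f).

Lemma sorted_labels_eq (T : subgraph n) v p : is_subgraph T ->
  path (adj T) v p ->
  sorted (fun a b : R => a <= b) (path_labels lam v p) =
  sorted (fun a b : R => a <= b) (path_labels lam' v p).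
Proof.
move=> sT; case: p => //= x p /andP[vx]; rewrite /path_labels.
elim: p v x vx => //= y p IH v x vx /andP[xy py].
rewrite same; [|by case: (sT _ vx)|by case: (sT _ xy)].
by congr (_ && _); exact: IH.
Qed.

Lemma increasing_tree_eq v T : increasing_tree lam v T <-> increasing_tree lam' v T.
Proof.
split=> -[tT vT r]; split => // u /r[p [pp up lp sp]]; exists p; split => //;
by move: sp; rewrite (@sorted_labels_eq T) //; case: tT.
Qed.

Lemma next_edge_eq v T : next_edge E lam v T = next_edge E lam' v T.
Proof.
rewrite /next_edge; have aE : admissible E lam v T = admissible E lam' v T.
  apply/setP => e; rewrite !inE; congr (_ && _).
  by apply/asboolP/asboolP => /increasing_tree_eq.
rewrite aE; apply: eq_pick => e /=; case eA: (e \in _) => //=.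
have inE' f : f \in admissible E lam' v T -> f \in E.
  by rewrite !inE => /andP[/andP[]].
by apply: eq_forallb_in => f fA; rewrite same ?inE'.
Qed.

Lemma process_tree_eq v k : process_tree E lam v k = process_tree E lam' v k.
Proof. by elim: k => //= k ->; rewrite next_edge_eq. Qed.

End OrderInvariance.
End Process.

(** * Counting on the grid *)

Lemma card_ord_lt (M t : nat) : #|[set a : 'I_M | (a < t)%N]| = minn t M.
Proof.
have [tM|Mt] := leqP t M.
  by rewrite -sum1dep_card (big_ord_narrow tM) sum1_card card_ord.
rewrite -[RHS]card_ord; apply: eq_card => a; rewrite !inE.
exact: leq_trans (ltn_ord a) (ltnW Mt).
Qed.

(* The right-hand side is [j], unless the window is cut at the top of the grid. *)
Lemma card_window (M K r y j : nat) : (r < K)%N ->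
  #|[set a : 'I_M | (y < (a * K + r).+1 <= y + j * K)%N]| =
  (minn ((y + (K.-1 - r)) %/ K + j) M - minn ((y + (K.-1 - r)) %/ K) M)%N.
Proof.
move=> rK; have K0 : (0 < K)%N by lia.
have above z a : (z < (a * K + r).+1)%N = ((z + (K.-1 - r)) %/ K <= a)%N.
  by rewrite -[RHS]ltnS ltn_divLR // mulSn; apply/idP/idP; lia.
have below z a : ((a * K + r).+1 <= z)%N = (a < (z + (K.-1 - r)) %/ K)%N.
  by rewrite leqNgt above -ltnNge.
set s := (_ %/ K)%N; rewrite -!card_ord_lt.
have -> : [set a : 'I_M | (y < (a * K + r).+1 <= y + j * K)%N] =
    [set a : 'I_M | (a < s + j)%N] :\: [set a : 'I_M | (a < s)%N].
  apply/setP => a; rewrite !inE above below -leqNgt.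
  by rewrite [(y + j * K)%N]addnC -addnA divnMDl // -/s [(j + s)%N]addnC.
rewrite cardsD; congr (_ - _)%N; apply: eq_card => a; rewrite !inE.
by apply/andP/idP => [[]//|as']; split => //; lia.
Qed.

Lemma minn_window_le s j M : (minn (s + j) M - minn s M <= j)%N.
Proof. by lia. Qed.

Lemma minn_window_eq s j M : (s + j <= M)%N -> (minn (s + j) M - minn s M)%N = j.
Proof. by lia. Qed.

Lemma card_familyE (I J : finType) (Q : I -> {set J}) :
  #|family Q| = (\prod_i #|Q i|)%N.
Proof.
under [RHS]eq_bigr do rewrite -sum1_card.
by rewrite bigA_distr_big_dep -sum1_card; apply: eq_bigr => f _; rewrite big1.
Qed.

Section Grid.
Variables (R : realType) (n M : nat).
Local Notation E := (complete_graph n).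
Local Notation K := #|{set 'I_n}|.
Local Notation grid := {ffun {set 'I_n} -> 'I_M}.

(* The rank of [e] breaks the ties between edges in the same cell. *)
Definition label_of (a : nat) (e : {set 'I_n}) : nat := (a * K + enum_rank e).+1.

Definition label (c : grid) (e : {set 'I_n}) : R := (label_of (c e) e)%:R.

Definition time (c : grid) (v : 'I_n) (k : nat) : nat :=
  if k is j.+1 then
    oapp (fun e => label_of (c e) e) 0%N
      (next_edge E (label c) v (process_tree E (label c) v j))
  else 0%N.

Local Notation st c v k := (process_tree E (label c) v k).

Lemma label_gt0 c e : 0 < label c e.
Proof. by rewrite ltr0n. Qed.

Lemma label_of_inj a b e f : label_of a e = label_of b f -> e = f.
Proof.
move=> -[] /(congr1 (modn^~ K)).
rewrite !modnMDl !modn_small ?ltn_ord // => h.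
by apply: enum_rank_inj; apply: val_inj.
Qed.

Lemma label_inj c : injective (label c).
Proof.
by move=> e f /eqP; rewrite eqr_nat => /eqP; exact: label_of_inj.
Qed.

Lemma YE c v k : Y E (label c) v k = (time c v k)%:R.
Proof. by case: k => //= k; case: next_edge. Qed.

Lemma label_of_le (a : 'I_M) e : (label_of a e <= M * K)%N.
Proof.
apply: (@leq_trans (a.+1 * K)); last by rewrite leq_mul2r ltn_ord orbT.
by rewrite mulSn addnC ltn_add2l.
Qed.

Lemma time_le c v k : (time c v k <= M * K)%N.
Proof. by case: k => //= k; case: next_edge => //= e; apply: label_of_le. Qed.

(** Off the boundary the cell is frozen. With [y] the current time this describes the histories that
    agree with [c]; with a later [y] it describes the event that the next step comes after [y]. *)
Definition avail c v k y (e : {set 'I_n}) : {set 'I_M} :=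
  if e \in boundary E (st c v k).1 then
    [set a : 'I_M | ((label_of a e)%:R < edge_arrival (label c) v k e)
                    || (y < label_of a e)%N]
  else [set c e].

(* The cell choices that agree with [c] on everything revealed by the first
   [k] steps of the process. *)
Definition history_class v k c : {set grid} :=
  [set c' in family (avail c v k (time c v k))].

Lemma history_class_stable v k c c' : (k < n)%N -> c' \in history_class v k c ->
  forall j, (j <= k)%N ->
    [/\ st c' v j = st c v j, time c' v j = time c v j &
        arrival (label c') v j = arrival (label c) v j].
Proof.
move=> kn; rewrite inE => /familyP cc' j jk.
have [e eB|e eB|sE yE aE] := process_resample (lam' := label c') (v := v)
    kn (@label_gt0 c) (@label_inj c) (@label_gt0 c') (@label_inj c') _ _ jk.
- by have := cc' e; rewrite /avail (negPf eB) inE /label => /eqP->.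
- by have := cc' e; rewrite /avail eB inE YE ltr_nat => /orP[]; [left|right].
by split => //; apply/eqP; move/eqP: yE; rewrite !YE eqr_nat.
Qed.

Lemma history_class_refl v k c : (k < n)%N -> c \in history_class v k c.
Proof.
move=> kn; rewrite inE; apply/familyP => e; rewrite /avail.
case: ifP => eB; rewrite inE //.
have := boundary_label (@label_gt0 c) (@label_inj c) kn eB.
by rewrite YE ltr_nat => -[]->; rewrite ?orbT.
Qed.

(** Together with [history_class_refl], this makes the classes a partition of the grid, the counting
    form of conditioning on the first [k] steps. *)
Lemma history_class_eq v k c c' : (k < n)%N -> c' \in history_class v k c ->
  history_class v k c' = history_class v k c.
Proof.
move=> kn cc'; have [sE yE aE] := history_class_stable kn cc' (leqnn k).
move: cc'; rewrite inE => /familyP cc'.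
apply/setP => x; rewrite !inE; apply: eq_forallb => e; rewrite /finfun.fmem.
suff -> : avail c' v k (time c' v k) e = avail c v k (time c v k) e by [].
have := cc' e; rewrite /avail /edge_arrival sE yE aE.
by case: ifP => // _; rewrite inE => /eqP->.
Qed.

Definition tail v k j c : {set grid} :=
  [set c' in history_class v k c | (time c v k + j * K < time c' v k.+1)%N].

(** By [lt_Y], the tail event only prolongs the forbidden window of every boundary edge by [j * K]
    labels, so it is again a product set. *)
Lemma tailE v k j c : (k.+1 < n)%N ->
  tail v k j c = [set c' in family (avail c v k (time c v k + j * K))].
Proof.
move=> kn; have kn' := ltnW kn; apply/setP => c'; rewrite inE.
apply/andP/idP => [[cc' lt]|].
  have [sE yE aE] := history_class_stable kn' cc' (leqnn k).
  move: lt; rewrite -(ltr_nat R) -YE lt_Y //.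
  move=> /forall_inP h; rewrite inE; apply/familyP => e.
  move: cc'; rewrite inE => /familyP/(_ e); rewrite /avail.
  case: ifP => // eB _; have := h e; rewrite sE => /(_ eB).
  by rewrite /edge_arrival sE aE /label ltr_nat inE.
rewrite inE => /familyP h.
have cc' : c' \in history_class v k c.
  rewrite inE; apply/familyP => e; have := h e; rewrite /avail.
  case: ifP => // _; rewrite !inE => /orP[->//|lt].
  by rewrite (leq_ltn_trans _ lt) ?orbT ?leq_addr.
split => //; have [sE yE aE] := history_class_stable kn' cc' (leqnn k).
rewrite -(ltr_nat R) -YE lt_Y //.
apply/forall_inP => e; rewrite sE => eB; have := h e.
by rewrite /avail eB inE /edge_arrival sE aE /label ltr_nat.
Qed.

Lemma card_class v k y c :
  #|[set c' in family (avail c v k y)]| = (\prod_e #|avail c v k y e|)%N.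
Proof. by rewrite cardsE card_familyE. Qed.

Lemma card_avail_window c v k j e : (k < n)%N -> e \in boundary E (st c v k).1 ->
  let y := time c v k in
  #|avail c v k y e| = (#|avail c v k (y + j * K) e| +
    #|[set a : 'I_M | (y < (a * K + enum_rank e).+1 <= y + j * K)%N]|)%N.
Proof.
move=> kn eB y; rewrite /avail eB.
have := edge_arrival_le (@label_gt0 c) (@label_inj c) kn eB.
rewrite YE -/y => ay; rewrite -cardsUI.
rewrite (_ : _ :&: _ = finset.set0) ?cards0 ?addn0; last first.
  apply/setP => a; rewrite !inE -/(label_of a e); apply/negP => /andP[].
  case/orP => [lt|lt] /andP[le1 le2]; last by rewrite ltnNge le2 in lt.
  by have := lt_le_trans lt ay; rewrite ltr_nat ltnNge ltnW.
apply: eq_card => a; rewrite !inE -/(label_of a e).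
case: (_ < _) => //=; have [h|h] /= := ltnP (y + j * K) (label_of a e).
  by apply: leq_ltn_trans h; rewrite leq_addr.
by rewrite andbT.
Qed.

Lemma prod_const_boundary v k c (x : R) :
  \prod_e (if e \in boundary E (st c v k).1 then x else 1) =
  x ^+ #|boundary E (st c v k).1|.
Proof. by rewrite -big_mkcond prodr_const. Qed.

(** When the window fits into the grid, each boundary edge loses exactly [j] of its at most [M]
    available cells. *)
Lemma tail_le v k j c : (k.+1 < n)%N -> (j <= M)%N ->
  #|tail v k j c|%:R <= (1 - j%:R / M%:R) ^+ #|boundary E (st c v k).1|
                        * #|history_class v k c|%:R :> R.
Proof.
move=> kn jM; have kn' := ltnW kn.
have M0 : (0 < M)%N.
  by have := ltn_ord (c finset.set0); lia.
have rho0 : 0 <= 1 - j%:R / M%:R :> R.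
  by rewrite subr_ge0 ler_pdivrMr ?ltr0n // mul1r ler_nat.
(* A window reaching beyond the largest label leaves no room for a later step, so the tail is
   empty. *)
have [cap|cap] := leqP (time c v k + j * K) (M * K); last first.
  have -> : tail v k j c = finset.set0.
    apply/setP => c'; rewrite !inE; apply/negP => /andP[_].
    by have := time_le c' v k.+1; lia.
  by rewrite cards0 mulr_ge0 // exprn_ge0.
rewrite tailE // /history_class !card_class !natr_prod -prod_const_boundary -big_split /=.
apply: ler_prod => e _; rewrite ler0n /=.
case: ifP => eB; last by rewrite mul1r /avail eB.
have := card_avail_window j kn' eB; rewrite /= card_window //.
set A := #|_|; set A' := #|_|; move=> AA.
have AM : (A <= M)%N by rewrite -[M]card_ord max_card.
have {}AA : A = (A' + j)%N.
  rewrite AA minn_window_eq //; set s := (_ %/ K)%N.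
  have K0 : (0 < K)%N by exact: leq_trans (ltn_ord (enum_rank e)).
  have : ((time c v k + (K.-1 - enum_rank e) + j * K) %/ K <= M)%N.
    rewrite -ltnS ltn_divLR // mulSn; lia.
  by rewrite addnC divnMDl // addnC.
have -> : A'%:R = A%:R - j%:R :> R by rewrite AA natrD addrK.
rewrite mulrBl mul1r lerD2l lerN2 mulrAC ler_pdivrMr ?ltr0n //.
by rewrite ler_wpM2l // ler_nat.
Qed.

(** Forbidden labels lie below [q * K], so at least [M - q] cells are available to each boundary
    edge, and the window removes at most [j] of them. *)
Lemma tail_ge v k j q c : (k.+1 < n)%N -> (time c v k <= q * K)%N ->
  (q < M)%N -> (j <= M - q)%N ->
  (1 - j%:R / (M - q)%:R) ^+ #|boundary E (st c v k).1| * #|history_class v k c|%:R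
  <= #|tail v k j c|%:R :> R.
Proof.
move=> kn tq qM jM; have kn' := ltnW kn.
have D0 : 0 < (M - q)%:R :> R by rewrite ltr0n subn_gt0.
have rho0 : 0 <= 1 - j%:R / (M - q)%:R :> R.
  by rewrite subr_ge0 ler_pdivrMr // mul1r ler_nat.
rewrite tailE // /history_class !card_class !natr_prod -prod_const_boundary -big_split /=.
apply: ler_prod => e _; apply/andP; split.
  by apply: mulr_ge0 => //; case: ifP.
case: ifP => eB; last by rewrite mul1r /avail eB.
have := card_avail_window j kn' eB; rewrite /= card_window //.
set A := #|_|; set A' := #|_|; set W := (_ - _)%N; move=> AA.
have Wj : (W <= j)%N by exact: minn_window_le.
have AD : (M - q <= A)%N.
  have := card_window M 0 q (ltn_ord (enum_rank e)); rewrite add0n => cW.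
  have : (#|~: avail c v k (time c v k) e| <= q)%N.
    apply: (@leq_trans #|[set a : 'I_M | (0 < (a * K + enum_rank e).+1 <= q * K)%N]|).
      apply/subset_leq_card/fintype.subsetP => a; rewrite /avail eB !inE negb_or -leqNgt.
      by move=> /andP[_ le]; apply: leq_trans le tq.
    by rewrite cW; exact: minn_window_le.
  have := cardsC (avail c v k (time c v k) e); rewrite card_ord -/A => cE h.
  by rewrite leq_subLR addnC -[X in (X <= _)%N]cE leq_add2l.
have {}AA : A%:R - j%:R <= A'%:R :> R.
  by rewrite lerBlDr -natrD ler_nat AA leq_add2l.
apply: le_trans AA; rewrite mulrBl mul1r lerB // mulrAC ler_pdivlMr //.
by rewrite ler_wpM2l // ler_nat.
Qed.

End Grid.

(** * Conditional moments of the increments *)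

Section RealInequalities.
Variable R : realType.
Implicit Types x y : R.

Lemma expR_le_inv x : 0 <= x -> x < 1 -> expR x <= (1 - x)^-1.
Proof.
move=> x0 x1; rewrite -[expR x]invrK -expRN lef_pV2 ?posrE ?expR_gt0 ?subr_gt0 //.
exact: expR_ge1Dx.
Qed.

(* This replaces Hoeffding's lemma: for a centred variable the linear term
   disappears, whatever the size of the variable. *)
Lemma expR_le_quadratic x : expR x <= x + expR (2 * x ^+ 2).
Proof.
have q y : 1 + y <= expR y by exact: expR_ge1Dx.
have := q (2 * x ^+ 2) => qx.
have [x0|x0] := leP 0 x; last first.
  have -> : expR x = (expR (- x))^-1 by rewrite expRN invrK.
  have h := q (- x); have e0 := expR_gt0 (- x).
  have : (expR (- x))^-1 <= (1 - x)^-1 by rewrite lef_pV2 ?posrE //; lra.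
  have : (1 - x)^-1 <= 1 + x + x ^+ 2.
    by rewrite -[_^-1]mul1r ler_pdivrMr; nra.
  nra.
have [x2|x2] := leP x 2^-1.
  have x1 : x < 1 by lra.
  have := expR_le_inv x0 x1.
  have : (1 - x)^-1 <= 1 + x + 2 * x ^+ 2.
    by rewrite -[_^-1]mul1r ler_pdivrMr; nra.
  lra.
have : expR x <= expR (2 * x ^+ 2) by rewrite ler_expR; nra.
lra.
Qed.

(** The mean value bounds for a power. With [x - y] one grid step, they compare each term of the
    Riemann sums below with a term of a telescoping sum. *)
Lemma exprS_diff N x y : 0 <= y -> y <= x ->
  N.+1%:R * (x - y) * y ^+ N <= x ^+ N.+1 - y ^+ N.+1 <= N.+1%:R * (x - y) * x ^+ N.
Proof.
move=> y0 yx; have xy : 0 <= x - y by rewrite subr_ge0.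
have x0 : 0 <= x by exact: le_trans yx.
rewrite subrXX ![N.+1%:R * _]mulrC -!mulrA !ler_wpM2l //.
  rewrite [X in _ <= X * _](_ : _ = \sum_(i < N.+1) 1) ?mulr_suml; last first.
    by rewrite sumr_const card_ord.
  apply: ler_sum => i _; rewrite mul1r /= (_ : x ^+ N = x ^+ (N - i) * x ^+ i); last first.
    by rewrite -exprD subnK // leq_ord.
  by rewrite ler_wpM2l ?exprn_ge0 // lerXn2r.
rewrite [X in X * _](_ : _ = \sum_(i < N.+1) 1) ?mulr_suml; last first.
  by rewrite sumr_const card_ord.
apply: ler_sum => i _; rewrite mul1r /= (_ : y ^+ N = y ^+ (N - i) * y ^+ i); last first.
  by rewrite -exprD subnK // leq_ord.
by rewrite ler_wpM2r ?exprn_ge0 // lerXn2r.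
Qed.

(** The right-hand side is [M] times the integral of [(1 - x)^N] over [[0,1]], and the sum takes
    right endpoints of a decreasing function. *)
Lemma riemann_upper (M C N : nat) : (0 < M)%N -> (C <= M)%N ->
  \sum_(j < C) (1 - j.+1%:R / M%:R) ^+ N <= M%:R / N.+1%:R :> R.
Proof.
move=> M0 CM; have M0' : 0 < M%:R :> R by rewrite ltr0n.
rewrite ler_pdivlMr ?ltr0n // -[leRHS]mulr1 -ler_pdivrMl //.
pose u (j : nat) : R := 1 - j%:R / M%:R.
have u0 j : (j <= M)%N -> 0 <= u j.
  by move=> jM; rewrite subr_ge0 ler_pdivrMr // mul1r ler_nat.
suff : M%:R^-1 * ((\sum_(j < C) u j.+1 ^+ N) * N.+1%:R) <= u 0%N ^+ N.+1 - u C ^+ N.+1.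
  move=> h; apply: le_trans h _; rewrite /u mul0r subr0 expr1n.
  by have := exprn_ge0 N.+1 (u0 _ CM); rewrite /u; lra.
rewrite mulr_suml mulr_sumr -(big_mkord xpredT (fun j => _ * (u j.+1 ^+ N * _))).
rewrite -opprB -(telescope_sumr (fun j => u j ^+ N.+1)) // -sumrN.
rewrite !big_nat; apply: ler_sum => j /andP[_ jC].
have [/= jM jM'] : (j <= M)%N /\ (j.+1 <= M)%N by lia.
have uu : u j - u j.+1 = M%:R^-1 by rewrite /u -natr1; field; rewrite gt_eqF.
have uj : u j.+1 <= u j by rewrite -subr_ge0 uu invr_ge0.
have /andP[+ _] := exprS_diff N (u0 _ jM') uj.
by rewrite uu; lra.
Qed.

(** The two losses against the full integral are the missing first cell, bounded by Bernoulli's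
    inequality, and the part beyond the truncation at [C], bounded by an exponential. *)
Lemma riemann_lower (D C N : nat) : (C < D)%N ->
  D%:R / N.+1%:R * (1 - N.+1%:R / D%:R - expR (- (C.+1%:R / D%:R * N%:R))) <=
  \sum_(j < C) (1 - j.+1%:R / D%:R) ^+ N :> R.
Proof.
move=> CD; have D0 : 0 < D%:R :> R by rewrite ltr0n; lia.
pose u (j : nat) : R := 1 - j%:R / D%:R.
have u0 j : (j <= D)%N -> 0 <= u j.
  by move=> jD; rewrite subr_ge0 ler_pdivrMr // mul1r ler_nat.
have step : u 1%N ^+ N.+1 - u C.+1 ^+ N.+1 <= N.+1%:R / D%:R * \sum_(j < C) u j.+1 ^+ N.
  rewrite mulr_sumr -(big_mkord xpredT (fun j => _ * u j.+1 ^+ N)).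
  rewrite -opprB -(telescope_sumr (fun j => u j.+1 ^+ N.+1)) // -sumrN.
  rewrite !big_nat; apply: ler_sum => j /andP[_ jC].
  have [/= jM jM'] : (j.+1 <= D)%N /\ (j.+2 <= D)%N by lia.
  have uu : u j.+1 - u j.+2 = D%:R^-1 by rewrite /u -[j.+2%:R]natr1; field; rewrite gt_eqF.
  have uj : u j.+2 <= u j.+1 by rewrite -subr_ge0 uu invr_ge0 ltW.
  have /andP[_] := exprS_diff N (u0 _ jM') uj.
  by rewrite uu; lra.
have bern : 1 - N.+1%:R / D%:R <= u 1%N ^+ N.+1.
  have u1 : 0 <= u 1%N by apply: u0; lia.
  have u1' : u 1%N <= 1 by rewrite /u gerBl divr_ge0.
  have /andP[_] := exprS_diff N u1 u1'.
  by rewrite !expr1n mulr1 /u; lra.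
have ex : u C.+1 ^+ N.+1 <= expR (- (C.+1%:R / D%:R * N%:R)).
  have le1 : u C.+1 <= expR (- (C.+1%:R / D%:R)) by exact: expR_ge1Dx.
  have e1 : expR (- (C.+1%:R / D%:R)) <= 1 :> R by rewrite -expR0 ler_expR oppr_le0 divr_ge0.
  rewrite -mulNr expRM_natr; apply: le_trans (_ : expR (- (C.+1%:R / D%:R)) ^+ N.+1 <= _).
    by rewrite lerXn2r // nnegrE ?u0 // expR_ge0.
  by rewrite exprS ler_piMl // exprn_ge0 // expR_ge0.
rewrite -[D%:R / _]invf_div ler_pdivrMl ?(divr_gt0 (ltr0Sn _ _) D0) //.
by apply: le_trans step; lra.
Qed.

End RealInequalities.

(** The tower property of conditional expectation in counting form: [F] is constant on classes, so
    [g] may be replaced by its class average. *)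
Lemma class_average (R : realType) (T : finType) (cl : T -> {set T})
    (F g : T -> R) (b : R) :
  (forall c, c \in cl c) -> (forall c c', c' \in cl c -> cl c' = cl c) ->
  (forall c c', c' \in cl c -> F c' = F c) ->
  (forall c, F c * \sum_(c' in cl c) g c' <= F c * (b * #|cl c|%:R)) ->
  \sum_c F c * g c <= b * \sum_c F c.
Proof.
move=> refl eqv Finv h.
have sym c c' : (c' \in cl c) = (c \in cl c').
  by apply/idP/idP => /eqv e; rewrite e refl.
have cl0 c : #|cl c|%:R != 0 :> R.
  by rewrite pnatr_eq0 -lt0n; apply/card_gt0P; exists c.
have -> : \sum_c F c * g c =
    \sum_c \sum_(c' in cl c) F c' * g c' / #|cl c'|%:R.
  rewrite (exchange_big_dep xpredT) //=; apply: eq_bigr => c _.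
  under eq_bigl do rewrite sym.
  by rewrite sumr_const -[RHS]mulr_natr divfK.
rewrite mulr_sumr; apply: ler_sum => c _.
rewrite [leLHS](_ : _ = F c * (\sum_(c' in cl c) g c') / #|cl c|%:R).
  by rewrite ler_pdivrMr ?lt0r ?cl0 //= -mulrA mulrCA; exact: h.
rewrite mulr_sumr mulr_suml; apply: eq_bigr => c' cc'.
by rewrite (Finv _ _ cc') (eqv _ _ cc').
Qed.

Section Moments.
Variables (R : realType) (n M : nat) (v : 'I_n).
Local Notation E := (complete_graph n).
Local Notation K := #|{set 'I_n}|.
Local Notation grid := {ffun {set 'I_n} -> 'I_M}.
Local Notation tm c k := (time R c v k).
Local Notation hclass k c := (history_class R v k c).
Local Notation st c k := (process_tree E (label R c) v k).

(** The number of boundary edges after [k] steps, when the tree has [k + 1] vertices; it governs the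
    increment of index [k + 1]. *)
Definition trials k : nat := (k.+1 * (n - k.+1))%N.

(* The increment between steps [k] and [k + 1], counted in cells. *)
Definition gap (c : grid) (k : nat) : nat := ((tm c k.+1 - tm c k).-1 %/ K)%N.

Lemma card_boundary_tree k (c : grid) : (k < n)%N -> #|boundary E (st c k).1| = trials k.
Proof.
move=> kn; rewrite card_boundary.
by have [_ ->] := process_inv v (@label_gt0 R n M c) kn.
Qed.

Lemma time_ltS k (c : grid) : (k.+1 < n)%N -> (tm c k < tm c k.+1)%N.
Proof.
move=> kn; rewrite -(ltr_nat R) -!YE.
exact: (@Y_ltS R n (label R c) v (@label_gt0 R n M c) (@label_inj R n M c) k kn).
Qed.

Lemma time_homo j k (c : grid) : (j <= k)%N -> (k < n)%N -> (tm c j <= tm c k)%N.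
Proof.
move=> jk kn; rewrite -(ler_nat R) -!YE.
exact: (Y_homo v (@label_gt0 R n M c) (@label_inj R n M c) jk kn).
Qed.

Lemma cells_gt0 : (0 < K)%N.
Proof. by apply/card_gt0P; exists finset.set0. Qed.

(** The predecessor in [gap] is there to produce the strict inequality that defines [tail]. *)
Lemma leq_gap k j (c : grid) : (k.+1 < n)%N ->
  (j <= gap c k)%N = (tm c k + j * K < tm c k.+1)%N.
Proof.
move=> kn; rewrite /gap leq_divRL ?cells_gt0 //.
by have := time_ltS c kn; lia.
Qed.

Lemma tail_gap k j (c : grid) : (k.+1 < n)%N ->
  tail R v k j c = [set c' in hclass k c | (j <= gap c' k)%N].
Proof.
move=> kn; apply/setP => c'; rewrite [LHS]inE [RHS]inE.
case: (boolP (c' \in hclass k c)) => //= c'c.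
by have [_ <- _] := history_class_stable (ltnW kn) c'c (leqnn k); rewrite leq_gap.
Qed.

Lemma minnE (g C : nat) : minn g C = (\sum_(j < C) (j < g)%N)%N.
Proof. by rewrite -card_ord_lt -sum1dep_card big_mkcond. Qed.

(** The layer-cake formula: a truncated variable is the sum of the indicators of its tail events. *)
Lemma sum_gap k C (c : grid) : (k.+1 < n)%N ->
  (\sum_(c' in hclass k c) minn (gap c' k) C = \sum_(j < C) #|tail R v k j.+1 c|)%N.
Proof.
move=> kn; under eq_bigr do rewrite minnE.
rewrite exchange_big /=; apply: eq_bigr => j _.
rewrite tail_gap // -sum1dep_card big_mkcondr /=.
by apply: eq_bigr => c' _; case: ltnP.
Qed.

Lemma mean_gap_le k C (c : grid) : (k.+1 < n)%N -> (C <= M)%N ->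
  \sum_(c' in hclass k c) (minn (gap c' k) C)%:R <=
  #|hclass k c|%:R * (M%:R / (trials k).+1%:R) :> R.
Proof.
move=> kn CM; rewrite -natr_sum sum_gap // natr_sum.
have M0 : (0 < M)%N by have := ltn_ord (c finset.set0); lia.
apply: le_trans (ler_wpM2l (ler0n _ _) (riemann_upper R (trials k) M0 CM)).
rewrite mulr_sumr; apply: ler_sum => j _; rewrite mulrC.
rewrite -(card_boundary_tree c (ltnW kn)); apply: tail_le => //.
exact: leq_trans (ltn_ord j) CM.
Qed.

Lemma mean_gap_ge k C q (c : grid) : (k.+1 < n)%N -> (C + q < M)%N -> (tm c k <= q * K)%N ->
  #|hclass k c|%:R * ((M - q)%:R / (trials k).+1%:R *
    (1 - (trials k).+1%:R / (M - q)%:R - expR (- (C.+1%:R / (M - q)%:R * (trials k)%:R))))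
  <= \sum_(c' in hclass k c) (minn (gap c' k) C)%:R :> R.
Proof.
move=> kn CM tq; rewrite -natr_sum sum_gap // natr_sum.
have CD : (C < M - q)%N by lia.
apply: (le_trans (ler_wpM2l (ler0n _ _) (riemann_lower R (trials k) CD))).
rewrite mulr_sumr; apply: ler_sum => j _; rewrite mulrC.
rewrite -(card_boundary_tree c (ltnW kn)); apply: tail_ge => //; first by lia.
by have := ltn_ord j; lia.
Qed.

Lemma class_sum_const (T : finType) (A : {set T}) (x : R) :
  \sum_(c in A) x = #|A|%:R * x.
Proof. by rewrite sumr_const -[LHS]mulr_natl. Qed.

Section Exponential.
Variables (C : nat -> nat) (b : nat -> R) (th : R).
Hypotheses (th0 : 0 <= th) (CM : forall k, (k.+1 < n)%N -> (C k <= M)%N).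
Let mu k : R := (trials k).+1%:R^-1.
Hypothesis bC : forall k, (k.+1 < n)%N -> (C k)%:R / M%:R <= b k.
Hypothesis bmu : forall k, (k.+1 < n)%N -> mu k <= b k.

Definition deviation c k : R := (minn (gap c k) (C k))%:R / M%:R - mu k.

Lemma deviation_sqr c k : (k.+1 < n)%N -> deviation c k ^+ 2 <= b k ^+ 2.
Proof.
move=> kn; rewrite -[leLHS]real_normK ?num_real // lerXn2r ?nnegrE //.
  by apply: le_trans (bmu kn); rewrite invr_ge0.
have mu0 : 0 <= mu k by rewrite invr_ge0.
have x0 : 0 <= (minn (gap c k) (C k))%:R / M%:R :> R by rewrite divr_ge0.
have xb : (minn (gap c k) (C k))%:R / M%:R <= b k.
  by apply: le_trans (bC kn); rewrite ler_wpM2r ?invr_ge0 // ler_nat geq_minr.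
by have := bmu kn; rewrite /deviation ler_norml; lra.
Qed.

Lemma exp_deviation (s : R) c k : (k.+1 < n)%N -> s ^+ 2 = th ^+ 2 ->
  expR (s * deviation c k) <= s * deviation c k + expR (2 * th ^+ 2 * b k ^+ 2).
Proof.
move=> kn sth; apply: le_trans (expR_le_quadratic _) _; rewrite lerD2l ler_expR.
by rewrite exprMn sth -mulrA ler_pM2l // ler_wpM2l ?sqr_ge0 ?deviation_sqr.
Qed.

(** After [exp_deviation], the linear term has a nonpositive sum by [mean_gap_le], and only the
    quadratic exponential remains. *)
Lemma upper_step c k : (k.+1 < n)%N ->
  \sum_(c' in hclass k c) expR (th * deviation c' k) <=
  expR (2 * th ^+ 2 * b k ^+ 2) * #|hclass k c|%:R.
Proof.
move=> kn; apply: le_trans (ler_sum _ (fun c' _ => exp_deviation c' kn (erefl (th ^+ 2)))) _.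
rewrite big_split /= class_sum_const mulrC gerDr -mulr_sumr mulr_ge0_le0 //.
rewrite big_split /= class_sum_const mulrN -mulr_suml subr_le0.
have M0 : (0 < M)%N by have := ltn_ord (c finset.set0); lia.
rewrite ler_pdivrMr ?ltr0n // -mulrA [_ * M%:R]mulrC.
exact: mean_gap_le kn (CM kn).
Qed.

(** Here the mean may fall short by [beta k], which enters the exponent through [1 + x <= expR x].
    The lower bound on the mean requires the current time to be at most [q] cells. *)
Lemma lower_step q (beta : nat -> R) c k : (k.+1 < n)%N -> (C k + q < M)%N ->
  (tm c k <= q * K)%N -> 0 <= beta k ->
  mu k - (M - q)%:R / (trials k).+1%:R *
    (1 - (trials k).+1%:R / (M - q)%:R
       - expR (- ((C k).+1%:R / (M - q)%:R * (trials k)%:R))) / M%:R <= beta k ->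
  \sum_(c' in hclass k c) expR (- th * deviation c' k) <=
  expR (2 * th ^+ 2 * b k ^+ 2 + th * beta k) * #|hclass k c|%:R.
Proof.
move=> kn CMq tq b0 hb.
apply: le_trans (ler_sum _ (fun c' _ => exp_deviation c' kn (sqrrN th))) _.
rewrite big_split /= class_sum_const -mulr_sumr.
have M0 : (0 < M)%N by have := ltn_ord (c finset.set0); lia.
have mean : - (\sum_(c' in hclass k c) deviation c' k) <= beta k * #|hclass k c|%:R.
  rewrite big_split /= class_sum_const -mulr_suml opprD mulrN opprK.
  have := mean_gap_ge kn CMq tq; set m := (_ * (1 - _ - _)) => h.
  have : #|hclass k c|%:R * m / M%:R <=
      (\sum_(c' in hclass k c) (minn (gap c' k) (C k))%:R) / M%:R.
    by rewrite ler_wpM2r ?invr_ge0.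
  have := ler_wpM2l (ler0n R #|hclass k c|) hb; rewrite -/m; lra.
have E1 : 1 <= expR (2 * th ^+ 2 * b k ^+ 2) :> R.
  by rewrite -[leLHS]expR0 ler_expR mulr_ge0 ?sqr_ge0 // mulr_ge0 ?sqr_ge0.
have tb0 : 0 <= th * beta k by exact: mulr_ge0.
rewrite expRD mulNr -mulrN; set e1 := expR (2 * _ * _) in E1 *.
have E2 : 1 + th * beta k <= expR (th * beta k) by exact: expR_ge1Dx.
set e2 := expR _ in E2 *; set h := #|_|%:R in mean *.
have h0 : 0 <= h by rewrite ler0n.
have := ler_wpM2l th0 mean => mean'; apply: le_trans (lerD mean' (lexx _)) _.
have -> : th * (beta k * h) + h * e1 = (th * beta k + e1) * h by ring.
rewrite ler_wpM2r //; nra.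
Qed.

End Exponential.

(** The supermartingale induction: within a history class the earlier factors are constant, and the
    last factor is averaged. *)
Lemma chain_moments (g : nat -> grid -> R) (B : nat -> R) :
  (forall i c, 0 <= g i c) -> (forall i, 0 <= B i) ->
  (forall k i c c', (k < n)%N -> (i < k)%N -> c' \in hclass k c -> g i c' = g i c) ->
  (forall k c, (k.+1 < n)%N ->
     \sum_(c' in hclass k c) g k c' <= B k * #|hclass k c|%:R) ->
  forall k, (k < n)%N ->
    \sum_c \prod_(i < k) g i c <= #|{: grid}|%:R * \prod_(i < k) B i.
Proof.
move=> g0 B0 ginv gB; elim=> [_|k IH kn].
  under eq_bigr do rewrite big_ord0.
  by rewrite big_ord0 mulr1 sumr_const.
under eq_bigr do rewrite big_ord_recr /=.
rewrite [in leRHS]big_ord_recr /= mulrA [leRHS]mulrC.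
apply: le_trans (ler_wpM2l (B0 k) (IH (ltnW kn))).
apply: (@class_average _ _ (fun c => hclass k c)).
- by move=> c; apply: history_class_refl; exact: ltnW.
- by move=> c c'; apply: history_class_eq; exact: ltnW.
- by move=> c c' cc'; apply: eq_bigr => i _; apply: ginv cc' => //; exact: ltnW.
- by move=> c; rewrite ler_wpM2l ?gB // prodr_ge0.
Qed.

End Moments.

(** * Concentration *)

Section Concentration.
Variables (R : realType) (n M : nat).
Local Notation K := #|{set 'I_n}|.
Local Notation grid := {ffun {set 'I_n} -> 'I_M}.
Local Notation tm c v k := (time R c v k).

Lemma markov_card (T : finType) (A : {set T}) (f : T -> R) :
  (forall c, 0 <= f c) -> (forall c, c \in A -> 1 <= f c) -> #|A|%:R <= \sum_c f c.
Proof.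
move=> f0 fA; rewrite -sum1_card natr_sum (bigID (mem A) xpredT) /=.
by rewrite -[leLHS]addr0 lerD ?sumr_ge0 // ler_sum.
Qed.

Section Tails.
Variable v : 'I_n.
Lemma gap_tail k j : (k.+1 < n)%N -> (j <= M)%N ->
  #|[set c : grid | (j <= gap R v c k)%N]|%:R <=
  #|{: grid}|%:R * (1 - j%:R / M%:R) ^+ trials n k :> R.
Proof.
move=> kn jM; have kn' := ltnW kn.
rewrite -sum1dep_card big_mkcond natr_sum [leRHS]mulrC.
have -> : #|{: grid}|%:R = \sum_(c : grid) 1 :> R by rewrite sumr_const.
under [leLHS]eq_bigr do rewrite -[_%:R]mul1r.
apply: (@class_average R _ (history_class R v k) (fun=> 1)) => //.
- by move=> c; exact: history_class_refl.
- by move=> c c'; exact: history_class_eq.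
move=> c; rewrite !mul1r -natr_sum -big_mkcondr sum1dep_card.
have -> : #|[set c' in history_class R v k c | (j <= gap R v c' k)%N]| = #|tail R v k j c|.
  by rewrite tail_gap.
by rewrite -(card_boundary_tree R v c kn'); exact: tail_le.
Qed.

Lemma time_le_gaps (c : grid) k : (k < n)%N ->
  (tm c v k <= (\sum_(i < k) (gap R v c i).+1) * K)%N.
Proof.
elim: k => [//|k IH kn]; rewrite big_ord_recr mulnDl.
apply: leq_trans (leq_add (IH (ltnW kn)) (leqnn _)).
by rewrite leqNgt -(leq_gap R v (gap R v c k).+1 c kn) ltnn.
Qed.

(** If every gap stays below [J i], then [time_le_gaps] bounds the total time; a union bound over
    the gaps does the rest. *)
Lemma time_tail (J : nat -> nat) : (0 < n)%N -> (forall i, (J i <= M)%N) ->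
  #|[set c : grid | (\sum_(i < n.-1) J i * K < tm c v n.-1)%N]|%:R <=
  #|{: grid}|%:R * \sum_(i < n.-1) (1 - (J i)%:R / M%:R) ^+ trials n i :> R.
Proof.
move=> n0 JM; rewrite mulr_sumr.
apply: (@le_trans _ _ (\sum_(i < n.-1) #|[set c : grid | (J i <= gap R v c i)%N]|%:R)); last first.
  by apply: ler_sum => i _; apply: gap_tail => //; have := ltn_ord i; lia.
rewrite -natr_sum ler_nat.
apply: (@leq_trans #|\bigcup_(i < n.-1) [set c : grid | (J i <= gap R v c i)%N]|).
  apply/subset_leq_card/fintype.subsetP => c; rewrite inE => lt.
  have [[i iJ]|no] := pselect (exists i : 'I_n.-1, (J i <= gap R v c i)%N).
    by apply/bigcupP; exists i; rewrite ?inE.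
  move: lt; rewrite ltnNge -big_distrl /= => /negP[].
  apply: leq_trans (time_le_gaps c _) _; first by rewrite prednK.
  rewrite leq_mul2r; apply/orP; right; apply: leq_sum => i _.
  by rewrite ltnNge; apply/negP => iJ; apply: no; exists i.
by elim/big_rec2: _ => [|i m A _ h]; rewrite ?cards0 // (leq_trans (leq_card_setU _ _)) // leq_add2l.
Qed.

Variables (C : nat -> nat) (b : nat -> R) (th : R).
Hypotheses (th0 : 0 <= th) (CM : forall k, (k.+1 < n)%N -> (C k <= M)%N).
Hypothesis bC : forall k, (k.+1 < n)%N -> (C k)%:R / M%:R <= b k.
Hypothesis bmu : forall k, (k.+1 < n)%N -> (trials n k).+1%:R^-1 <= b k.

Definition total_deviation (c : grid) k : R := \sum_(i < k) deviation R v C c i.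

Lemma deviation_stable k i (c c' : grid) : (k < n)%N -> (i < k)%N ->
  c' \in history_class R v k c -> deviation R v C c' i = deviation R v C c i.
Proof.
move=> kn ik cc'; rewrite /deviation /gap.
have [_ -> _] := history_class_stable kn cc' ik.
by have [_ -> _] := history_class_stable kn cc' (ltnW ik).
Qed.

Lemma upper_tail k t : (k < n)%N ->
  #|[set c : grid | t < total_deviation c k]|%:R <=
  #|{: grid}|%:R * expR (- (th * t) + \sum_(i < k) 2 * th ^+ 2 * b i ^+ 2).
Proof.
move=> kn; rewrite expRD mulrCA expR_sum.
have h := @chain_moments R n M v (fun i c => expR (th * deviation R v C c i))
  (fun i => expR (2 * th ^+ 2 * b i ^+ 2)).
apply: le_trans (ler_wpM2l (expR_ge0 _) (h _ _ _ _ _ kn)) => //.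
- rewrite mulr_sumr; apply: markov_card => c.
    by rewrite mulr_ge0 ?expR_ge0 // prodr_ge0 // => i _; exact: expR_ge0.
  rewrite inE => tW; rewrite -expR_sum -expRD -[leLHS]expR0 ler_expR -mulr_sumr.
  by rewrite addrC subr_ge0 ler_wpM2l // ltW.
- by move=> j i c c' jn ij cc'; rewrite (deviation_stable jn ij cc').
- by move=> j c jn; apply: upper_step.
Qed.

(** A factor is replaced by [0] once the time exceeds [q] cells, so that [lower_step] is only
    applied to fast histories. On the event counted here all factors survive, because the time is
    monotone in the step. *)
Lemma lower_tail k t q (beta : nat -> R) : (k < n)%N ->
  (forall j, (j.+1 < n)%N -> (C j + q < M)%N) -> (forall j, 0 <= beta j) ->
  (forall j, (j.+1 < n)%N -> (trials n j).+1%:R^-1 - (M - q)%:R / (trials n j).+1%:R *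
    (1 - (trials n j).+1%:R / (M - q)%:R
       - expR (- ((C j).+1%:R / (M - q)%:R * (trials n j)%:R))) / M%:R <= beta j) ->
  #|[set c : grid | (total_deviation c k < - t) && (tm c v k <= q * K)%N]|%:R <=
  #|{: grid}|%:R *
    expR (- (th * t) + \sum_(i < k) (2 * th ^+ 2 * b i ^+ 2 + th * beta i)).
Proof.
move=> kn CMq beta0 hb; rewrite expRD mulrCA expR_sum.
have h := @chain_moments R n M v
  (fun i c => if (tm c v i <= q * K)%N then expR (- th * deviation R v C c i) else 0)
  (fun i => expR (2 * th ^+ 2 * b i ^+ 2 + th * beta i)).
apply: le_trans (ler_wpM2l (expR_ge0 _) (h _ _ _ _ _ kn)) => //.
- rewrite mulr_sumr; apply: markov_card => c.
    rewrite mulr_ge0 ?expR_ge0 // prodr_ge0 // => i _; case: ifP => // _; exact: expR_ge0.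
  rewrite inE => /andP[tW tq].
  under eq_bigr => i _.
    rewrite (leq_trans (time_homo R v c (ltnW (ltn_ord i)) kn) tq).
    over.
  rewrite -expR_sum -expRD -[leLHS]expR0 ler_expR -mulr_sumr.
  by rewrite addrC subr_ge0 mulNr -mulrN ler_wpM2l // lerNr ltW.
- by move=> i c; case: ifP => // _; exact: expR_ge0.
- move=> j i c c' jn ij cc'; rewrite (deviation_stable jn ij cc').
  by have [_ -> _] := history_class_stable jn cc' (ltnW ij).
- move=> j c jn; have [tq|tq] := leqP (tm c v j) (q * K).
    rewrite (eq_bigr (fun c' => expR (- th * deviation R v C c' j))).
      by apply: (lower_step th0 bC bmu jn (CMq _ jn) tq (beta0 j) (hb _ jn)).
    move=> c' cc'; have [_ -> _] := history_class_stable (ltnW jn) cc' (leqnn j).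
    by rewrite tq.
  rewrite big1 ?mulr_ge0 ?expR_ge0 // => c' cc'.
  have [_ -> _] := history_class_stable (ltnW jn) cc' (leqnn j).
  by rewrite leqNgt tq.
Qed.

End Tails.

Definition bad_grids (C : nat -> nat) (t : R) : {set grid} :=
  [set c | [exists v : 'I_n, exists k : 'I_n, t < `|total_deviation v C c k|]].

Lemma card_exists_le (I T : finType) (A : I -> {set T}) (x : R) :
  (forall i, #|A i|%:R <= x) -> #|[set c | [exists i, c \in A i]]|%:R <= #|I|%:R * x.
Proof.
move=> h; apply: (@le_trans _ _ (\sum_i #|A i|%:R)); last first.
  by apply: le_trans (ler_sum _ (fun i _ => h i)) _; rewrite sumr_const -[leLHS]mulr_natl.
rewrite -natr_sum ler_nat; have -> : [set c | [exists i, c \in A i]] = \bigcup_i A i.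
  by apply/setP => c; rewrite inE; apply/existsP/bigcupP => -[i]; exists i.
by elim/big_rec2: _ => [|i m B _ h']; rewrite ?cards0 // (leq_trans (leq_card_setU _ _)) // leq_add2l.
Qed.

(** A union bound over roots, steps and both signs, plus for each root the event that the process
    lasts longer than [q] cells. [S], [B] and [e3] bound the variance proxy, the total bias and the
    probability of one large gap. *)
Lemma card_bad_grids (C J : nat -> nat) (b beta : nat -> R) (th t S B e3 : R) :
  (0 < n)%N -> 0 <= th -> 0 <= e3 ->
  let q := (\sum_(i < n.-1) J i)%N in
  (forall k, (k.+1 < n)%N -> (C k + q < M)%N) ->
  (forall i, (J i <= M)%N) ->
  (forall k, (k.+1 < n)%N -> (C k)%:R / M%:R <= b k) ->
  (forall k, (k.+1 < n)%N -> (trials n k).+1%:R^-1 <= b k) ->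
  (forall j, 0 <= beta j) ->
  (forall j, (j.+1 < n)%N -> (trials n j).+1%:R^-1 - (M - q)%:R / (trials n j).+1%:R *
    (1 - (trials n j).+1%:R / (M - q)%:R
       - expR (- ((C j).+1%:R / (M - q)%:R * (trials n j)%:R))) / M%:R <= beta j) ->
  \sum_(i < n.-1) b i ^+ 2 <= S -> \sum_(i < n.-1) beta i <= B ->
  (forall i, (i < n.-1)%N -> (1 - (J i)%:R / M%:R) ^+ trials n i <= e3) ->
  #|bad_grids C t|%:R <= #|{: grid}|%:R * (n%:R ^+ 2 *
    (2 * expR (- (th * t) + 2 * th ^+ 2 * S + th * B) + e3)).
Proof.
move=> n0 th0 e30 q CMq JM bC bmu beta0 hb hS hB he3.
have CM k : (k.+1 < n)%N -> (C k <= M)%N by move/CMq; lia.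
have prefix (f : nat -> R) k : (forall i, 0 <= f i) -> (k < n)%N ->
    \sum_(i < k) f i <= \sum_(i < n.-1) f i.
  move=> f0 kn; rewrite -!(big_mkord xpredT) [leRHS](big_cat_nat _ (n := k)) //=.
    by rewrite lerDl sumr_ge0.
  by lia.
have B0 : 0 <= B by apply: le_trans hB; rewrite sumr_ge0.
set e1 := expR _; set T := #|{: grid}|%:R.
have T0 : 0 <= T by rewrite /T ler0n.
have bound (v : 'I_n) (k : 'I_n) :
   #|[set c | t < total_deviation v C c k]|%:R <= T * e1 /\
   #|[set c | (total_deviation v C c k < - t) && (tm c v k <= q * K)%N]|%:R <= T * e1.
  have kn := ltn_ord k.
  have sb : \sum_(i < k) 2 * th ^+ 2 * b i ^+ 2 <= 2 * th ^+ 2 * S.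
    rewrite -mulr_sumr ler_wpM2l ?mulr_ge0 ?sqr_ge0 //.
    apply: le_trans hS; apply: (prefix (fun i => b i ^+ 2) k) => // i; exact: sqr_ge0.
  have sbeta : \sum_(i < k) th * beta i <= th * B.
    by rewrite -mulr_sumr ler_wpM2l //; apply: le_trans hB; exact: prefix.
  split.
    apply: le_trans (upper_tail v th0 CM bC bmu t kn) _.
    rewrite ler_wpM2l // ler_expR -addrA lerD2l (le_trans sb) // lerDl.
    exact: mulr_ge0.
  apply: le_trans (lower_tail v th0 bC bmu t kn CMq beta0 hb) _.
  by rewrite ler_wpM2l // ler_expR -addrA lerD2l big_split lerD.
have slow (v : 'I_n) : #|[set c : grid | (q * K < tm c v n.-1)%N]|%:R <= T * (n%:R * e3).
  have := time_tail v n0 JM; rewrite -big_distrl /= -/q => /le_trans; apply.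
  rewrite ler_wpM2l //; apply: (@le_trans _ _ (\sum_(i < n.-1) e3)).
    by apply: ler_sum => i _; exact: he3.
  rewrite sumr_const card_ord -[leLHS]mulr_natl ler_wpM2r ?ler_nat ?leq_pred //.
set Fast := fun (v : 'I_n) (k : 'I_n) => [set c : grid | t < total_deviation v C c k] :|:
  [set c : grid | (total_deviation v C c k < - t) && (tm c v k <= q * K)%N].
have fast (v k : 'I_n) : #|Fast v k|%:R <= T * e1 *+ 2.
  have [h1 h2] := bound v k; rewrite mulr2n; apply: le_trans (lerD h1 h2).
  by rewrite -natrD ler_nat leq_card_setU.
have fast' := card_exists_le (fun v => card_exists_le (fast v)).
have slow' := card_exists_le slow.
apply: (@le_trans _ _ (#|'I_n|%:R * (T * (n%:R * e3)) + #|'I_n|%:R * (#|'I_n|%:R * (T * e1 *+ 2)))).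
  apply: le_trans (lerD slow' fast'); rewrite -natrD ler_nat.
  apply: leq_trans (leq_card_setU _ _).
  apply/subset_leq_card/fintype.subsetP => c; rewrite !inE => /existsP[v /existsP[k tW]].
  have [tq|tq] := leqP (tm c v n.-1) (q * K); last first.
    by apply/orP; left; apply/existsP; exists v; rewrite inE.
  apply/orP; right; apply/existsP; exists v; rewrite inE; apply/existsP; exists k.
  rewrite !inE; apply/orP; move: tW; rewrite lter_normr => /orP[|tW]; [by left|right].
  have kn : (k <= n.-1)%N by rewrite -ltnS prednK.
  have nn : (n.-1 < n)%N by rewrite prednK.
  by rewrite ltrNr tW /= (leq_trans (time_homo R v c kn nn) tq).
rewrite !card_ord; lra.
Qed.

End Concentration.

(** * From the grid to the labels *)

Section Transfer.
Variables (R : realType) (n M : nat).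
Local Notation E := (complete_graph n).
Local Notation K := #|{set 'I_n}|.
Local Notation grid := {ffun {set 'I_n} -> 'I_M}.

Definition cell_itv (a : nat) : set R := [set` `[a%:R / M%:R, a.+1%:R / M%:R[].

Lemma cell_itvP a x : cell_itv a x <-> a%:R / M%:R <= x < a.+1%:R / M%:R.
Proof. by rewrite /cell_itv /= in_itv. Qed.

Lemma measurable_cell_itv a : measurable (cell_itv a).
Proof. exact: measurable_itv. Qed.

Lemma uniform_cell_itv (a : 'I_M) :
  uniform_prob (@ltr01 R) (cell_itv a) = (M%:R^-1)%:E.
Proof.
have M0 : 0 < M%:R :> R by rewrite ltr0n; have := ltn_ord a; lia.
rewrite /uniform_prob.
rewrite (eq_integral (fun=> 1%:E)); last first.
  move=> x; rewrite inE => /cell_itvP /andP[ax xa]; rewrite /uniform_pdf.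
  rewrite (le_trans _ ax) ?divr_ge0 // (ltW (lt_le_trans xa _)) //=.
    by rewrite subr0 invr1.
  by rewrite ler_pdivrMr // mul1r ler_nat.
rewrite integral_cst ?mul1e; last exact: measurable_cell_itv.
rewrite [LHS](lebesgue_measure_itv `[a%:R / M%:R, a.+1%:R / M%:R[).
rewrite /= lte_fin ltr_pM2r ?invr_gt0 // ltr_nat ltnSn.
by rewrite -EFinB -mulrBl -natrB ?leqnSn // subSnn mul1r.
Qed.

Section OneSample.
Variables (lam : {set 'I_n} -> R) (c : grid).
Hypotheses (lamc : forall e, e \in E -> cell_itv (c e) (lam e)) (cI : injective c).

Lemma cell_gt0 : (0 < M)%N.
Proof. exact: leq_ltn_trans (leq0n _) (ltn_ord (c finset.set0)). Qed.

(** Distinct cells are ordered like the labels inside them, so the ranks never decide between two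
    different edges. *)
Lemma order_cell e f : e \in E -> f \in E ->
  (lam e <= lam f) = (label R c e <= label R c f).
Proof.
have M0 := cell_gt0; have M0' : 0 < M%:R :> R by rewrite ltr0n.
have lt x y : x \in E -> y \in E -> (c x < c y)%N ->
    (lam x < lam y) && (label R c x < label R c y).
  move=> xE yE xy; apply/andP; split.
    have /cell_itvP/andP[_ h1] := lamc xE; have /cell_itvP/andP[h2 _] := lamc yE.
    apply: lt_le_trans h1 (le_trans _ h2).
    by rewrite ler_pM2r ?invr_gt0 // ler_nat.
  rewrite /label ltr_nat /label_of ltnS; apply: leq_trans (leq_addr _ _).
  apply: (@leq_trans ((c x).+1 * K)); last by rewrite leq_mul2r xy orbT.
  by rewrite mulSn addnC ltn_add2r.
move=> eE fE; have [/lt|/lt|] := ltngtP (c e) (c f).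
- by move=> /(_ eE fE) /andP[/ltW-> /ltW->].
- by move=> /(_ fE eE) /andP[]; rewrite !ltNge => /negbTE-> /negbTE->.
by move=> /val_inj/cI ->; rewrite !lexx.
Qed.

Let tree_eq v k : process_tree E lam v k = process_tree E (label R c) v k.
Proof. by apply: process_tree_eq => e f; exact: order_cell. Qed.

Lemma cell_Y v k : `|Y E lam v k - (time R c v k)%:R / (M * K)%:R| <= M%:R^-1.
Proof.
have M0 := cell_gt0; have M0' : 0 < M%:R :> R by rewrite ltr0n.
case: k => [|k]; first by rewrite /= mul0r subrr normr0 invr_ge0.
have K0 : 0 < K%:R :> R by rewrite ltr0n cells_gt0.
rewrite /= tree_eq (next_edge_eq order_cell).
case nE: next_edge => [e|] /=; last by rewrite mul0r subrr normr0 invr_ge0.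
have eE : e \in E.
  move: nE; rewrite /next_edge; case: pickP => // x /andP[xa _] [<-].
  by move: xa; rewrite !inE => /andP[/andP[]].
have /cell_itvP/andP[h1 h2] := lamc eE.
have l1 : (c e)%:R / M%:R <= (label_of (c e) e)%:R / (M * K)%:R :> R.
  rewrite natrM ler_pdivlMr ?mulr_gt0 // mulrA divfK ?gt_eqF // -natrM ler_nat.
  by rewrite /label_of ltnW // ltnS leq_addr.
have l2 : (label_of (c e) e)%:R / (M * K)%:R <= (c e).+1%:R / M%:R :> R.
  rewrite natrM ler_pdivrMr ?mulr_gt0 // mulrA divfK ?gt_eqF // -natrM ler_nat.
  by rewrite /label_of mulSn addnC ltn_add2r.
have : (c e).+1%:R / M%:R = (c e)%:R / M%:R + M%:R^-1 :> R.
  by rewrite -natr1 mulrDl mul1r.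
by rewrite ler_norml; lra.
Qed.

(** Each of the two times contributes an error of one cell, and the rounding in [gap] a third. *)
Lemma cell_X v k : (k.+1 < n)%N ->
  `|X E lam v k.+1 - (gap R v c k)%:R / M%:R| <= 3 / M%:R.
Proof.
move=> kn; have M0 := cell_gt0; have M0' : 0 < M%:R :> R by rewrite ltr0n.
have K0 : 0 < K%:R :> R by rewrite ltr0n cells_gt0.
have y1 := cell_Y v k.+1; have y0 := cell_Y v k.
have lt := time_ltS R v c kn.
have : ((gap R v c k)%:R / M%:R <= ((time R c v k.+1)%:R - (time R c v k)%:R) / (M * K)%:R :> R) /\
    (((time R c v k.+1)%:R - (time R c v k)%:R) / (M * K)%:R
      <= (gap R v c k).+1%:R / M%:R :> R).
  have e (a : nat) : a%:R / M%:R = (a * K)%:R / (M * K)%:R :> R.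
    by rewrite !natrM -mulf_div divff ?mulr1 // gt_eqF.
  rewrite !e !ler_pM2r ?invr_gt0 ?natrM ?mulr_gt0 // -natrB ?(ltnW lt) // -!natrM !ler_nat.
  have := leq_gap R v (gap R v c k) c kn; have := leq_gap R v (gap R v c k).+1 c kn.
  rewrite leqnn ltnn => /esym/negbT; rewrite -leqNgt => h1 /esym h2.
  by split; lia.
rewrite -natr1 !mulrDl mulNr mul1r => -[].
move: y1 y0; rewrite /X /= -/(Y E lam v k.+1) -/(time R c v k.+1) !ler_norml; lra.
Qed.

Hypothesis cut0 : forall k, (k.+1 < n)%N -> 0 <= cutoff R n k.+1.

Definition cutoff_cells (k : nat) : nat := Num.trunc (M%:R * cutoff R n k.+1).

Lemma cutoff_cells_itv k : (k.+1 < n)%N ->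
  (cutoff_cells k)%:R / M%:R <= cutoff R n k.+1 < (cutoff_cells k).+1%:R / M%:R.
Proof.
move=> kn; have M0 := cell_gt0; have M0' : 0 < M%:R :> R by rewrite ltr0n.
rewrite ler_pdivrMr // ltr_pdivlMr // [_ * M%:R]mulrC.
by apply: truncn_itv; rewrite mulr_ge0 ?cut0.
Qed.

(** Rounding the cutoff costs at most one cell, and a minimum incurs the larger of two errors rather
    than their sum. *)
Lemma cell_Xhat v k : (k.+1 < n)%N ->
  `|Xhat E lam v k.+1 - (minn (gap R v c k) (cutoff_cells k))%:R / M%:R| <= 3 / M%:R.
Proof.
move=> kn; have M0 := cell_gt0; have M0' : 0 < M%:R :> R by rewrite ltr0n.
have /andP[] := cutoff_cells_itv kn; rewrite -natr1 mulrDl mul1r.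
have := cell_X v kn; have iM : 0 < M%:R^-1 :> R by rewrite invr_gt0.
set g := gap _ _ _ _; set C := cutoff_cells k.
have gC : (minn g C)%:R / M%:R = Num.min (g%:R / M%:R) (C%:R / M%:R) :> R.
  by rewrite natr_min minr_pMl // invr_ge0 ltW.
rewrite gC /Xhat !ler_norml !minElt.
case: (ltP (X _ _ _ _)); case: (ltP (g%:R / M%:R)); lra.
Qed.

Lemma cell_Yhat v k : (k < n)%N ->
  `|Yhat E lam v k - \sum_(1 <= i < k.+1) ((i * (n - i))%:R + 1)^-1| <=
  `|total_deviation R v cutoff_cells c k| + 3 * k%:R / M%:R.
Proof.
move=> kn; rewrite /Yhat !big_add1 /= !big_mkord -sumrB.
have -> : \sum_(i < k) (Xhat E lam v i.+1 - ((i.+1 * (n - i.+1))%:R + 1)^-1) =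
    total_deviation R v cutoff_cells c k + \sum_(i < k) (Xhat E lam v i.+1
      - (minn (gap R v c i) (cutoff_cells i))%:R / M%:R).
  rewrite /total_deviation -big_split; apply: eq_bigr => i _.
  by rewrite /deviation /trials natr1 /=; ring.
apply: le_trans (ler_normD _ _) _; rewrite lerD2l.
apply: le_trans (ler_norm_sum _ _ _) _.
apply: (@le_trans _ _ (\sum_(i < k) 3 / M%:R)).
  by apply: ler_sum => i _; apply: cell_Xhat; apply: leq_ltn_trans kn.
by rewrite sumr_const card_ord -[leLHS]mulr_natl mulrCA mulrA.
Qed.

End OneSample.

(** * Probability of grid cells and measurability of the event *)

Section Probability.
Variables (d : measure_display) (Omega : measurableType d) (P : probability Omega R).
Variable lam : {set 'I_n} -> {RV P >-> R}.
Hypothesis lamU : uniform_labels lam.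

Definition grid_cell (c : grid) : set Omega :=
  [set w | forall e, e \in E -> cell_itv (c e) (lam e w)]%classic.

Lemma measurable_preimage e (B : set R) : measurable B -> measurable (lam e @^-1` B)%classic.
Proof. by move=> mB; rewrite -[X in measurable X]setTI; exact: measurable_funP. Qed.

Lemma measurable_grid_cell c : measurable (grid_cell c).
Proof.
rewrite (_ : grid_cell c = \bigcap_(e in [set` E]) (lam e @^-1` cell_itv (c e)))%classic.
  apply: fin_bigcap_measurable; first exact: finite_finset.
  by move=> e _; apply: measurable_preimage; exact: measurable_cell_itv.
by apply/seteqP; split.
Qed.

Lemma grid_cell_prob c : P (grid_cell c) = ((M%:R^-1) ^+ #|E|)%:E.
Proof.
have [unif indep] := lamU.
rewrite /grid_cell (indep E (fun e => cell_itv (c e))) //; last first.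
  by move=> e _; exact: measurable_cell_itv.
rewrite (eq_bigr (fun=> (M%:R^-1)%:E)); last first.
  move=> e eE; have := unif e eE _ (measurable_cell_itv (c e)).
  by rewrite uniform_cell_itv => <-.
by rewrite prodEFin prodr_const.
Qed.

Lemma cell_itv_inj (a b : nat) x : cell_itv a x -> cell_itv b x -> a = b.
Proof.
move=> /cell_itvP/andP[a1 a2] /cell_itvP/andP[b1 b2].
have [M0|M0] := posnP M; first by move: (le_lt_trans a1 a2); rewrite M0 invr0 !mulr0 ltxx.
have M0' : 0 < M%:R^-1 :> R by rewrite invr_gt0 ltr0n.
apply/eqP; rewrite eqn_leq; apply/andP; split; rewrite -ltnS -(ltr_nat R) -(ltr_pM2r M0').
  exact: le_lt_trans a1 b2.
exact: le_lt_trans b1 a2.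
Qed.

Lemma prob_ge_grid (A : set Omega) (G : {set grid}) : (0 < M)%N -> measurable A ->
  (forall c, c \in G -> (grid_cell c `<=` A)%classic) ->
  ((#|G|%:R / #|{: grid}|%:R)%:E <= P A)%E.
Proof.
(* A grid also assigns cells to sets that are not edges. Resetting these coordinates gives
   representatives with disjoint events, each coming from at most [M ^ #|~: E|] elements of [G]. *)
move=> M0 mA GA; pose r (c : grid) : grid := [ffun e => if e \in E then c e else Ordinal M0].
have rcell c : grid_cell (r c) = grid_cell c.
  by apply/seteqP; split=> w h e eE; have := h e eE; rewrite ffunE eE.
pose D : {set grid} := [set r c | c in G].
have card_G : (#|G| <= #|D| * M ^ #|~: E|)%N.
  rewrite -sum1_card (partition_big r (mem D)) /=; last by move=> c cG; apply: imset_f.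
  rewrite -sum_nat_const; apply: leq_sum => c0 _; rewrite sum1dep_card.
  apply: (@leq_trans #|family (fun e => if e \in E then [set c0 e] else [set: 'I_M])|).
    apply/subset_leq_card/fintype.subsetP => c; rewrite inE => /andP[_ /eqP rc].
    by apply/familyP => e; case: ifP => eE; rewrite inE // -rc ffunE eE.
  rewrite card_familyE (bigID (mem E)) /= big1 ?mul1n; last first.
    by move=> e ->; rewrite cards1.
  rewrite (eq_bigr (fun=> M)); last by move=> e /negPf ->; rewrite cardsT card_ord.
  rewrite prod_nat_const leq_pexp2l //; apply/subset_leq_card/fintype.subsetP => e eE.
  by rewrite finset.in_setC.
have sub : (\bigcup_(c in [set` D]) grid_cell c `<=` A)%classic.
  by move=> w [c0 /imsetP[c cG ->]]; rewrite rcell; exact: GA.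
have mD c : [set` D]%classic c -> measurable (grid_cell c).
  by move=> _; exact: measurable_grid_cell.
have fD : finite_set [set` D] by exact: finite_finset.
have mU := fin_bigcup_measurable fD mD.
apply: le_trans (le_measure P (mem_set mU) (mem_set mA) sub).
rewrite measure_fin_bigcup //; last first.
  move=> _ _ /imsetP[c cG ->] /imsetP[c' cG' ->] [w [h h']].
  apply/ffunP => e; rewrite !ffunE; case: ifP => // eE; apply: val_inj.
  have := h e eE; have := h' e eE; rewrite !ffunE eE => a b.
  exact: cell_itv_inj b a.
have -> : [set` D]%classic = [set` enum D]%classic.
  by apply/seteqP; split => c /=; rewrite mem_enum.
rewrite -fsbig_seq ?enum_uniq // (eq_bigr (fun=> ((M%:R^-1) ^+ #|E|)%:E)); last first.
  by move=> c _; exact: grid_cell_prob.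
rewrite sumEFin lee_fin big_enum sumr_const -[leRHS]mulr_natl.
rewrite ler_pdivrMr ?ltr0n; last first.
  by apply/card_gt0P; exists [ffun=> Ordinal M0].
have M0' : M%:R != 0 :> R by rewrite pnatr_eq0 -lt0n.
rewrite card_ffun card_ord -(cardsC E) expnD natrM !natrX exprVn -mulrA mulKf ?expf_neq0 //.
by rewrite -natrX -natrM ler_nat.
Qed.

(** There are finitely many comparison patterns of the labels, each a measurable event, and [A] is a
    union of such events. *)
Lemma measurable_order_invariant (A : set Omega) :
  (forall w w', (forall e f, e \in E -> f \in E ->
     (lam e w <= lam f w) = (lam e w' <= lam f w')) -> A w -> A w') ->
  measurable A.
Proof.
move=> inv; pose code w := [ffun p : {set 'I_n} * {set 'I_n} =>
  [&& p.1 \in E, p.2 \in E & lam p.1 w <= lam p.2 w]].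
rewrite (_ : A = \bigcup_(o in code @` A) \bigcap_(p in [set: {set 'I_n} * {set 'I_n}])
    [set w | [&& p.1 \in E, p.2 \in E & lam p.1 w <= lam p.2 w] = o p])%classic.
  apply: fin_bigcup_measurable; first exact: finite_finset.
  move=> o _; apply: fin_bigcap_measurable; first exact: finite_finset.
  move=> p _;
  have mle : measurable_fun [set: Omega] (fun w => lam p.1 w <= lam p.2 w).
    by apply: measurable_realfun.measurable_fun_ler; exact: measurable_funP.
  case pE : ((p.1 \in E) && (p.2 \in E)); last first.
    case: (o p); [rewrite (_ : [set _ | _] = set0)%classic //|
                  rewrite (_ : [set _ | _] = setT)%classic //];
    by apply/seteqP; split => w //=; rewrite andbA pE.
  have := mle measurableT [set o p]%classic I; rewrite setTI.
  by congr measurable; apply/seteqP; split => w /=; rewrite andbA pE.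
apply/seteqP; split=> [w Aw|w].
  by exists (code w); [exists w|move=> p _ /=; rewrite ffunE].
case=> x [w' Aw' <-] h.
apply: inv Aw' => e f eE fE; have := h (e, f) I.
by rewrite /= ffunE /= eE fE.
Qed.

(** Splitting by the chosen edge leaves an order-invariant event intersected with a preimage under a
    single label. *)
Lemma measurable_Y v k : measurable_fun [set: Omega] (fun w => Y E (lam^~ w) v k).
Proof.
case: k => [|k]; first exact: measurable_cst.
move=> _ B mB; rewrite setTI.
pose nx w := next_edge E (lam^~ w) v (process_tree E (lam^~ w) v k).
rewrite (_ : _ @^-1` B = \bigcup_(x in [set: option {set 'I_n}])
    ([set w | nx w = x] `&` [set w | B (oapp (lam^~ w) 0 x)]))%classic.
  apply: fin_bigcup_measurable; first exact: finite_finset.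
  move=> x _; apply: measurableI.
    apply: measurable_order_invariant => w w' ww' <-.
    by rewrite /= /nx (next_edge_eq ww') (process_tree_eq ww').
  case: x => [e|] /=; first exact: measurable_preimage.
  have [B0|B0] := pselect (B 0).
    by rewrite (_ : [set _ | _] = setT)%classic //; apply/seteqP; split.
  by rewrite (_ : [set _ | _] = set0)%classic //; apply/seteqP; split.
apply/seteqP; split => [w Bw|w [x _ [/= <- //]]].
by exists (nx w).
Qed.

Lemma measurable_Yhat v k : measurable_fun [set: Omega] (fun w => Yhat E (lam^~ w) v k).
Proof.
apply: measurable_sum => i; rewrite /Xhat.
apply: measurable_realfun.measurable_minr; last exact: measurable_cst.
by apply: measurable_realfun.measurable_funB; exact: measurable_Y.
Qed.

Lemma measurable_good (a : nat -> R) (t : R) :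
  measurable [set w | forall (v : 'I_n) (k : nat), (1 <= k <= n - 1)%N ->
    `|Yhat E (lam^~ w) v k - a k| <= t]%classic.
Proof.
rewrite (_ : [set _ | _] = \bigcap_(v in [set: 'I_n])
    \bigcap_(k in [set k | (1 <= k <= n - 1)%N])
      [set w | `|Yhat E (lam^~ w) v k - a k| <= t])%classic; last first.
  apply/seteqP; split => [w h v _ k kn|w h v k kn]; first exact: h.
  exact: (h v I k kn).
apply: fin_bigcap_measurable; first exact: finite_finset.
move=> v _; apply: bigcap_measurableType => k _.
have mf : measurable_fun [set: Omega] (fun w => `|Yhat E (lam^~ w) v k - a k| <= t).
  apply: measurable_realfun.measurable_fun_ler; last exact: measurable_cst.
  apply: measurableT_comp => //.
  by apply: measurable_realfun.measurable_funB; [exact: measurable_Yhat|exact: measurable_cst].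
by have := mf measurableT [set true]%classic I; rewrite setTI; congr measurable; apply/seteqP; split.
Qed.

End Probability.

Lemma card_noninjective : (0 < M)%N ->
  #|[set c : grid | ~~ injectiveb c]|%:R <= #|{: grid}|%:R * (K%:R ^+ 2 / M%:R) :> R.
Proof.
move=> M0; rewrite mulrA ler_pdivlMr ?ltr0n // -natrX -!natrM ler_nat.
pose A (p : {set 'I_n} * {set 'I_n}) := [set c : grid | (p.1 != p.2) && (c p.1 == c p.2)].
have cA p : (#|A p| * M <= #|{: grid}|)%N.
  rewrite -[M in (_ * M)%N]card_ord -cardsT -cardsX.
  (* In a grid where [p.1] and [p.2] collide, the cell of [p.1] can be overwritten freely and
     recovered from that of [p.2]; hence at most one grid in [M] collides at [p]. *)
  pose f (x : grid * 'I_M) : grid := [ffun e => if e == p.1 then x.2 else x.1 e].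
  rewrite -(@card_in_imset _ _ f) ?max_card // => -[c a] [c' a'].
  rewrite !inE /= => /andP[/andP[ne /eqP c12] _] /andP[/andP[_ /eqP c12'] _] /ffunP h.
  have aa : a = a' by have := h p.1; rewrite !ffunE /= eqxx.
  congr (_, _) => //; apply/ffunP => e.
  have [->|ep] := eqVneq e p.1.
    by have := h p.2; rewrite !ffunE eq_sym (negPf ne) /= -c12 -c12'.
  by have := h e; rewrite !ffunE (negPf ep).
apply: (@leq_trans ((\sum_p #|A p|) * M)).
  rewrite leq_mul2r; apply/orP; right.
  apply: (@leq_trans #|\bigcup_p A p|).
    apply/subset_leq_card/fintype.subsetP => c; rewrite inE => /injectivePn[e [f ef cef]].
    by apply/bigcupP; exists (e, f); rewrite // inE ef cef eqxx.
  by elim/big_rec2: _ => [|i m B _ h']; rewrite ?cards0 // (leq_trans (leq_card_setU _ _)) // leq_add2l.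
rewrite big_distrl /=.
apply: (@leq_trans (\sum_(p : {set 'I_n} * {set 'I_n}) #|{: grid}|)).
  by apply: leq_sum => p _; exact: cA.
by rewrite sum_nat_const card_prod mulnC -mulnn.
Qed.

End Transfer.

(** * Estimates *)

Section Estimates.
Variable R : realType.
Implicit Types (x s : R) (n m : nat).

(** The exponent six suits [n_ge_pow]: at [x = s^80] it yields [s^480 / 6^6], which exceeds
    [s^400]. *)
Lemma expR_ge_pow6 x : 0 <= x -> (x / 6) ^+ 6 <= expR x.
Proof.
move=> x0; have -> : expR x = expR (x / 6) ^+ 6.
  by rewrite -expRM_natr divfK.
rewrite lerXn2r ?nnegrE ?expR_ge0 ?divr_ge0 //.
by apply: le_trans (expR_ge1Dx _); rewrite lerDr.
Qed.

Lemma harmonic_le m : \sum_(i < m) (i.+1%:R)^-1 <= 1 + ln (m%:R) :> R.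
Proof.
case: m => [|m]; first by rewrite big_ord0 ln0 // addr0.
elim: m => [|m IH]; first by rewrite big_ord_recr big_ord0 /= add0r invr1 ln1 addr0.
rewrite big_ord_recr /=; apply: le_trans (lerD IH (lexx _)) _.
rewrite -addrA lerD2l -lerBrDl.
have x0 : 0 < m.+1%:R :> R by rewrite ltr0n.
have y0 : 0 < m.+2%:R :> R by rewrite ltr0n.
have e : - (m.+2%:R)^-1 = m.+1%:R / m.+2%:R - 1 :> R.
  by rewrite -[m.+2%:R]natr1; field; apply: lt0r_neq0; lra.
have x1 : 0 < m.+1%:R / m.+2%:R :> R by rewrite divr_gt0.
have h : ln (m.+1%:R / m.+2%:R) <= - (m.+2%:R)^-1 :> R.
  rewrite (_ : _ / _ = 1 + - (m.+2%:R)^-1); last by rewrite e addrC subrK.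
  by apply: le_ln1Dx; rewrite e ltrBrDl subrr.
rewrite -opprB lerNr; apply: le_trans h; rewrite lnM ?posrE ?invr_gt0 //.
by rewrite lnV ?posrE.
Qed.

Lemma sum_three_halves m : \sum_(i < m) (i.+1%:R * Num.sqrt i.+1%:R)^-1 <= 3 :> R.
Proof.
(* The induction needs the sharper bound: one plus the integral of [x^(-3/2)] from [1] to
   [m + 1]. *)
suff : forall m, \sum_(i < m.+1) (i.+1%:R * Num.sqrt i.+1%:R)^-1 <=
    3 - 2 / Num.sqrt m.+1%:R :> R.
  case: m => [_|m /(_ m)]; first by rewrite big_ord0.
  by move=> /le_trans; apply; rewrite gerBl divr_ge0 ?sqrtr_ge0.
elim=> [|{}m IH]; first by rewrite big_ord_recr big_ord0 /= add0r sqrtr1 mulr1 invr1; lra.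
rewrite big_ord_recr /=; apply: le_trans (lerD IH (lexx _)) _.
set a := Num.sqrt m.+1%:R; set b := Num.sqrt m.+2%:R.
have a0 : 0 < a by rewrite sqrtr_gt0 ltr0n.
have b0 : 0 < b by rewrite sqrtr_gt0 ltr0n.
have aa : a ^+ 2 = m.+1%:R by rewrite sqr_sqrtr ?ler0n.
have bb : b ^+ 2 = m.+2%:R by rewrite sqr_sqrtr ?ler0n.
have ab : b ^+ 2 = a ^+ 2 + 1 by rewrite aa bb natr1.
have le_ab : a <= b by rewrite ler_wsqrtr // ler_nat.
rewrite -bb -exprSr.
suff : (b ^+ 3)^-1 <= 2 / a - 2 / b by lra.
have -> : 2 / a - 2 / b = 2 * (b - a) / (a * b) by field; rewrite !gt_eqF.
rewrite ler_pdivlMr ?mulr_gt0 // mulrC ler_pdivrMr ?exprn_gt0 //.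
have h1 : (b - a) * (a + b) = 1 by rewrite -[RHS](addrK (a ^+ 2)) [1 + _]addrC -ab; ring.
have h2 : 1 <= (b - a) * (2 * b) by rewrite -[leLHS]h1 ler_wpM2l //; lra.
have h3 : a <= b * ((b - a) * (2 * b)) by apply: le_trans le_ab _; rewrite ler_peMr // ltW.
rewrite (_ : 2 * (b - a) * b ^+ 3 = b * (b * ((b - a) * (2 * b)))); last by ring.
by rewrite mulrC ler_pM2l.
Qed.

Lemma sum_rev (f : nat -> R) n : \sum_(i < n.-1) f (n - i.+1)%N = \sum_(i < n.-1) f i.+1.
Proof.
rewrite (reindex_inj rev_ord_inj) /=; apply: eq_bigr => i _; congr f.
by have := ltn_ord i; lia.
Qed.

(** Partial fractions of [1 / (a b)] with [a + b = n], which reduce the sum over all steps to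
    harmonic sums. *)
Lemma trials_inv n i : (i < n.-1)%N ->
  (trials n i)%:R^-1 = n%:R^-1 * ((i.+1%:R)^-1 + ((n - i.+1)%:R)^-1) :> R.
Proof.
move=> i_n; have ab : (i.+1 + (n - i.+1) = n)%N by lia.
rewrite /trials natrM; have : n%:R = i.+1%:R + (n - i.+1)%:R :> R by rewrite -natrD ab.
move=> ->; have x0 : 0 < i.+1%:R :> R by rewrite ltr0n.
have y0 : 0 < (n - i.+1)%:R :> R by rewrite ltr0n; lia.
by field; rewrite !gt_eqF //= addr_gt0.
Qed.

Lemma sum_trials_inv n : (1 < n)%N ->
  \sum_(i < n.-1) (trials n i)%:R^-1 <= 2 * (1 + ln n%:R) / n%:R :> R.
Proof.
move=> n1; rewrite (eq_bigr _ (fun (i : 'I_n.-1) _ => trials_inv (ltn_ord i))).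
rewrite -mulr_sumr big_split /= (sum_rev (fun j => (j%:R)^-1)).
rewrite mulrC ler_wpM2r ?invr_ge0 //; have := harmonic_le n.-1.
have : ln n.-1%:R <= ln n%:R :> R.
  by rewrite ler_ln ?posrE ?ltr0n; [rewrite ler_nat leq_pred|lia|lia].
lra.
Qed.

(* With [m] the smaller side and [y = m^(1/4)] the numerator is at most
   [8 y + 80 s], while [k (n - k) >= m n / 2]. *)
Lemma cutoff_sqr n s k : 1 <= s -> ln n%:R = s ^+ 80 -> (0 < k < n)%N ->
  cutoff R n k ^+ 2 <= (176 * s / n%:R) ^+ 2 *
    ((k%:R * Num.sqrt k%:R)^-1 + ((n - k)%:R * Num.sqrt (n - k)%:R)^-1).
Proof.
move=> s1 lnn /andP[k0 kn]; rewrite /cutoff; set m := minn k (n - k).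
have m0 : (0 < m)%N by rewrite /m; lia.
have n0 : (0 < n)%N by lia.
set y := Num.sqrt (Num.sqrt m%:R) : R.
have s0 : 0 < s by lra.
have sm1 : 1 <= Num.sqrt m%:R :> R by rewrite -[leLHS]sqrtr1 ler_wsqrtr // ler1n.
have y1 : 1 <= y by rewrite -[leLHS]sqrtr1 ler_wsqrtr.
have y0 : 0 < y by lra.
have y2 : y ^+ 2 = Num.sqrt m%:R by rewrite sqr_sqrtr // sqrtr_ge0.
have y4 : y ^+ 4 = m%:R by rewrite (exprM y 2 2) y2 sqr_sqrtr // ler0n.
have l1 : 0 <= (2 * ln m%:R + ln (ln n%:R) : R) <= 88 * (y * s).
  rewrite lnn lnXn // -y4 lnXn //.
  have := ln_sublinear s0; have := ln_sublinear y0.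
  have := ln_ge0 y1; have := ln_ge0 s1.
  have : y <= y * s by rewrite ler_peMr // ltW.
  have : s <= y * s by rewrite ler_peMl // ltW.
  rewrite -[ln s *+ 80]mulr_natr -[ln y *+ 4]mulr_natr => *; apply/andP; split; lra.
have key : cutoff R n k = (2 * ln m%:R + ln (ln n%:R)) / (k * (n - k))%:R by [].
have fm : (m%:R * Num.sqrt m%:R)^-1 <= (k%:R * Num.sqrt k%:R)^-1 +
    ((n - k)%:R * Num.sqrt (n - k)%:R)^-1 :> R.
  rewrite /m; case: (leqP k (n - k)) => h.
    by rewrite lerDl invr_ge0 mulr_ge0 ?sqrtr_ge0.
  by rewrite lerDr invr_ge0 mulr_ge0 ?sqrtr_ge0.
apply: le_trans (ler_wpM2l _ fm); last exact: sqr_ge0.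
have den : m%:R * n%:R / 2 <= (k * (n - k))%:R :> R.
  rewrite ler_pdivrMr // -!natrM ler_nat.
  have [/= e1 e2] : (k * (n - k) = m * maxn k (n - k))%N /\ (n <= 2 * maxn k (n - k))%N.
    by rewrite /m; case: (leqP k (n - k)) => h; split; lia.
  by rewrite e1 -mulnA leq_mul2l [(_ * 2)%N]mulnC e2 orbT.
have mn0 : 0 < m%:R * n%:R / 2 :> R by rewrite !mulr_gt0 ?ltr0n ?invr_gt0.
have /andP[l0 l2] := l1.
have le1 : (2 * ln m%:R + ln (ln n%:R)) / (k * (n - k))%:R <= 88 * (y * s) / (m%:R * n%:R / 2).
  apply: ler_pM => //.
  by rewrite lef_pV2 ?posrE // (lt_le_trans mn0).
have -> : (176 * s / n%:R) ^+ 2 * (m%:R * Num.sqrt m%:R)^-1 =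
    (88 * (y * s) / (m%:R * n%:R / 2)) ^+ 2.
  rewrite -y2 -y4; field; rewrite !gt_eqF ?ltr0n //.
by rewrite lerXn2r ?nnegrE ?divr_ge0 // ?mulr_ge0 // ?ltW.
Qed.

Lemma sum_cutoff_sqr n s : 1 <= s -> (1 < n)%N -> ln n%:R = s ^+ 80 ->
  \sum_(i < n.-1) cutoff R n i.+1 ^+ 2 <= 6 * (176 * s / n%:R) ^+ 2.
Proof.
move=> s1 n1 lnn.
apply: le_trans (ler_sum _ (fun (i : 'I_n.-1) _ =>
  cutoff_sqr s1 lnn (_ : (0 < i.+1 < n)%N))) _.
  by move=> i; have := ltn_ord i; lia.
rewrite -mulr_sumr big_split /= (sum_rev (fun j => (j%:R * Num.sqrt j%:R)^-1)).
have := sum_three_halves n.-1; set x := \sum_(i < _) _ => x3.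
by rewrite mulrC ler_wpM2r ?sqr_ge0 //; lra.
Qed.

End Estimates.

(** * Choice of the parameters *)

Lemma trials_eq0 n i : (n.-1 <= i)%N -> trials n i = 0%N.
Proof. by move=> ni; rewrite /trials (_ : n - i.+1 = 0)%N ?muln0 //; lia. Qed.

Lemma trials_gt0 n i : (i.+1 < n)%N -> (0 < trials n i)%N.
Proof. by move=> i_n; rewrite muln_gt0 /=; lia. Qed.

Lemma trials_ge n i : (i.+1 < n)%N -> (n <= trials n i * 2)%N.
Proof. by move=> i_n; rewrite /trials; nia. Qed.

Lemma side_gt0 n k : (k.+1 < n)%N -> (0 < minn k.+1 (n - k.+1))%N.
Proof. by move=> kn; lia. Qed.

Lemma side_le n k : (minn k.+1 (n - k.+1) <= n)%N.
Proof. by lia. Qed.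

(* With [s = (log n)^(1/80)] the deviation is [s^64 / n], the failure probability
   [exp (- s^120)], and the exponential moments are taken at [n s^60]; the factor
   [s^4] to spare absorbs [log log n <= 80 s]. *)
Section Constants.
Variables (R : realType) (n M : nat) (s : R).
Hypotheses (s_ge : 1000 <= s) (n1 : (1 < n)%N) (ln_n : ln n%:R = s ^+ 80).
Hypotheses (M0 : (0 < M)%N) (M_ge : n%:R ^+ 3 <= M%:R :> R).
Local Notation grid := {ffun {set 'I_n} -> 'I_M}.

Let s1 : 1 <= s. Proof. by apply: le_trans s_ge; rewrite ler1n. Qed.
Let s0 : 0 < s. Proof. exact: lt_le_trans ltr01 s1. Qed.
Let n0 : 0 < n%:R :> R. Proof. by rewrite ltr0n ltnW. Qed.
Let M0' : 0 < M%:R :> R. Proof. by rewrite ltr0n. Qed.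

Let s_pow i j : (i <= j)%N -> s ^+ i <= s ^+ j.
Proof. by move=> ij; apply: ler_weXn2l. Qed.

Let s_pow_ge i : 1000 * s ^+ i <= s ^+ i.+1.
Proof. by rewrite exprS ler_wpM2r // exprn_ge0 // ltW. Qed.

Let n_exp : n%:R = expR (s ^+ 80).
Proof. by rewrite -ln_n lnK. Qed.

Lemma n_ge_pow : s ^+ 400 <= n%:R.
Proof.
rewrite n_exp; apply: le_trans (expR_ge_pow6 (exprn_ge0 80 (ltW s0))).
rewrite exprMn exprVn -exprM ler_pdivlMr ?exprn_gt0 //.
rewrite (_ : 80 * 6 = 400 + 80)%N // exprD ler_wpM2l ?exprn_ge0 ?(ltW s0) //.
apply: (@le_trans _ _ (s ^+ 6)); last exact: s_pow.
by rewrite lerXn2r ?nnegrE ?(ltW s0) //; move: s_ge; lra.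
Qed.

Let n_ge_s i : (i <= 400)%N -> s ^+ i <= n%:R.
Proof. by move=> i4; apply: le_trans (s_pow i4) n_ge_pow. Qed.

Lemma trials_inv_le i : (trials n i)%:R^-1 <= 2 / n%:R :> R.
Proof.
(* Past the last step [trials] vanishes, and so does its inverse by convention. *)
have [i_n|i_n] := ltnP i n.-1; last first.
  by rewrite (trials_eq0 i_n) invr0 divr_ge0.
rewrite ltn_predRL in i_n.
have t0 : 0 < (trials n i)%:R :> R by rewrite ltr0n trials_gt0.
rewrite -[2 / _]invf_div lef_pV2 ?posrE ?divr_gt0 //.
by rewrite ler_pdivrMr // -natrM ler_nat trials_ge.
Qed.

Let H : R := \sum_(i < n.-1) (trials n i)%:R^-1.

Lemma sum_trials_inv_le : H <= 4 * s ^+ 80 / n%:R.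
Proof.
apply: le_trans (sum_trials_inv R n1) _; rewrite ln_n ler_wpM2r ?invr_ge0 //.
by have := s_pow (leq0n 80); rewrite expr0; lra.
Qed.

Let ln_s : 1 <= ln (s ^+ 80).
Proof.
rewrite lnXn // -mulr_natr.
have h : ln s^-1 <= s^-1 - 1.
  rewrite -{1}[s^-1](addrNK 1) [_ + 1]addrC; apply: le_ln1Dx.
  by have : 0 < s^-1 by [rewrite invr_gt0]; lra.
have h' : s^-1 <= 2^-1 by rewrite lef_pV2 ?posrE //; move: s_ge; lra.
by rewrite lnV ?posrE // in h; lra.
Qed.

Section Step.
Variables (k : nat) (kn : (k.+1 < n)%N).
Let N := trials n k.

Let N0 : 0 < N%:R :> R. Proof. by rewrite ltr0n trials_gt0. Qed.

Let side : 0 <= ln (minn k.+1 (n - k.+1))%:R :> R.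
Proof. by apply: ln_ge0; rewrite ler1n side_gt0. Qed.

Lemma cutoff_ge : N%:R^-1 <= cutoff R n k.+1.
Proof.
rewrite /cutoff -/N -[leLHS]mul1r ler_wpM2r ?invr_ge0 ?(ltW N0) //.
by rewrite ln_n; move: side ln_s; lra.
Qed.

Lemma cutoff_le : cutoff R n k.+1 <= 6 * s ^+ 80 / n%:R.
Proof.
rewrite (_ : 6 * s ^+ 80 / n%:R = 3 * s ^+ 80 * (2 / n%:R)); last by ring.
rewrite /cutoff ler_pM ?invr_ge0 ?(ltW N0) //; last exact: trials_inv_le.
  by rewrite ln_n; move: side ln_s; lra.
have : ln (minn k.+1 (n - k.+1))%:R <= s ^+ 80.
  by rewrite -ln_n ler_ln ?posrE ?ltr0n ?side_gt0 // ?(ltnW n1) // ler_nat side_le.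
by rewrite ln_n; have := ln_sublinear (exprn_gt0 80 s0); lra.
Qed.

(** This is what the [log log n] term of the cutoff is for: truncation loses at most a share
    [1 / log n] of the mean. *)
Lemma expR_cutoff : expR (- (cutoff R n k.+1 * N%:R)) <= (s ^+ 80)^-1.
Proof.
rewrite expRN lef_pV2 ?posrE ?expR_gt0 ?exprn_gt0 // -[leLHS]lnK ?posrE ?exprn_gt0 //.
rewrite ler_expR /cutoff -/N divfK ?gt_eqF // ln_n.
by move: side; lra.
Qed.

End Step.

(* An increment of [J i] cells has probability at most [exp (- s^160)], so that
   [q] cells bound the total time and [delta] bounds it as a fraction of [0,1]. *)
Let J i : nat := (Num.trunc (M%:R * s ^+ 160 / (trials n i)%:R)).+1.
Let q := (\sum_(i < n.-1) J i)%N.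
Let delta : R := 5 * s ^+ 240 / n%:R.

Let J_itv i : M%:R * s ^+ 160 / (trials n i)%:R <= (J i)%:R <=
  M%:R * s ^+ 160 / (trials n i)%:R + 1.
Proof.
have x0 : 0 <= M%:R * s ^+ 160 / (trials n i)%:R by rewrite divr_ge0 // mulr_ge0 // exprn_ge0 // ltW.
by have /andP[h1 h2] := truncn_itv x0; rewrite (ltW h2) /J -natr1 lerD2r.
Qed.

Let invM_le : M%:R^-1 <= (n%:R ^+ 3)^-1 :> R.
Proof. by rewrite lef_pV2 ?posrE ?exprn_gt0. Qed.

Let n_invM : n%:R / M%:R <= (n%:R ^+ 2)^-1 :> R.
Proof.
have := ler_wpM2l (ltW n0) invM_le.
rewrite (_ : n%:R * (n%:R ^+ 3)^-1 = (n%:R ^+ 2)^-1) //.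
by field; rewrite gt_eqF.
Qed.

Let inv_n2 : (n%:R ^+ 2)^-1 <= n%:R^-1 :> R.
Proof. by rewrite lef_pV2 ?posrE ?exprn_gt0 // expr2 ler_peMr ?ler1n ?(ltW n0) // ltnW. Qed.

(** Of the constant [5] in [delta], [4] comes from [sum_trials_inv_le] and the rest covers rounding
    each [J i] up. *)
Let q_le : q%:R / M%:R <= delta.
Proof.
have qH : q%:R <= M%:R * s ^+ 160 * H + n%:R.
  rewrite /q natr_sum; apply: (@le_trans _ _ (\sum_(i < n.-1)
      (M%:R * s ^+ 160 / (trials n i)%:R + 1))).
    by apply: ler_sum => i _; case/andP: (J_itv i).
  rewrite big_split /= -mulr_sumr -/H lerD2l sumr_const card_ord ler_nat.
  exact: leq_pred.
apply: (@le_trans _ _ (s ^+ 160 * H + n%:R / M%:R)).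
  rewrite ler_pdivrMr // mulrDl divfK ?gt_eqF //.
  by rewrite [s ^+ 160 * H * _]mulrC mulrA.
have h1 : s ^+ 160 * H <= s ^+ 160 * (4 * s ^+ 80 / n%:R).
  by rewrite ler_wpM2l ?sum_trials_inv_le // exprn_ge0 // ltW.
have h2 : n%:R^-1 <= s ^+ 240 / n%:R.
  by rewrite ler_peMl ?invr_ge0 ?(ltW n0) // exprn_ege1.
have e : s ^+ 160 * (4 * s ^+ 80 / n%:R) = 4 * (s ^+ 240 / n%:R).
  by rewrite (_ : 240 = 160 + 80)%N // exprD; ring.
rewrite /delta -mulrA; move: n_invM inv_n2; rewrite e in h1; lra.
Qed.

Let small a i : (i < 400)%N -> 0 <= a -> a <= 1000 -> a * s ^+ i / n%:R <= 1.
Proof.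
move=> i4 a0 a1; rewrite ler_pdivrMr // mul1r; apply: le_trans (n_ge_s i4).
by apply: le_trans (s_pow_ge i); rewrite ler_wpM2r // exprn_ge0 // ltW.
Qed.

Let s_n80 i : (i <= 240)%N -> s ^+ i / n%:R <= s ^+ 240 / n%:R.
Proof. by move=> i2; rewrite ler_wpM2r ?invr_ge0 ?(ltW n0) // s_pow. Qed.

Let J_le i : (J i <= M)%N.
Proof.
rewrite -(ler_nat R); have /andP[_ h] := J_itv i; apply: le_trans h _.
rewrite -[leRHS]mulr1 -lerBrDr -mulrA.
have t := ler_wpM2l (exprn_ge0 160 (ltW s0)) (trials_inv_le i).
have t2 : s ^+ 160 * (2 / n%:R) <= 2^-1.
  have := @small 4 160 isT ltac:(lra) ltac:(lra); rewrite -mulrA; lra.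
have : M%:R * (s ^+ 160 * (trials n i)%:R^-1) <= M%:R * 2^-1.
  by rewrite ler_pM2l //; lra.
have : 2 <= M%:R :> R.
  rewrite ler_nat -(ltr_nat R); apply: lt_le_trans M_ge.
  by rewrite -natrX ltr1n -[1%N](exp1n 3) ltn_exp2r.
lra.
Qed.

Let Cq k : (k.+1 < n)%N -> (cutoff_cells R n M k + q < M)%N.
Proof.
move=> kn; rewrite -(ltr_nat R) natrD -[ltRHS]mul1r -ltr_pdivrMr // mulrDl.
have cut0 j : (j.+1 < n)%N -> 0 <= cutoff R n j.+1.
  by move=> jn; apply: le_trans (cutoff_ge jn); rewrite invr_ge0.
have /andP[h _] := cutoff_cells_itv [ffun=> Ordinal M0] cut0 kn.
have := cutoff_le kn; have := q_le; rewrite /delta -!mulrA => h1 h2.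
have h3 : s ^+ 80 / n%:R <= s ^+ 240 / n%:R by exact: s_n80.
have := @small 100 240 isT ltac:(lra) ltac:(lra); rewrite -mulrA; lra.
Qed.

(* The bias of the truncated mean: resampling windows, truncation and rounding. *)
Let beta k : R := delta / (trials n k)%:R + (s ^+ 80)^-1 / (trials n k)%:R + M%:R^-1.

Let delta0 : 0 <= delta.
Proof. by apply: divr_ge0 (ltW n0); apply: mulr_ge0 => //; rewrite exprn_ge0 // ltW. Qed.

Let beta_ge k : (k.+1 < n)%N ->
  (trials n k).+1%:R^-1 - (M - q)%:R / (trials n k).+1%:R *
    (1 - (trials n k).+1%:R / (M - q)%:R
      - expR (- ((cutoff_cells R n M k).+1%:R / (M - q)%:R * (trials n k)%:R))) / M%:R
  <= beta k.
Proof.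
move=> kn; set N := trials n k; set ex := expR _.
have N0 : 0 < N%:R :> R by rewrite ltr0n trials_gt0.
have N10 : 0 < N.+1%:R :> R by rewrite ltr0n.
have qM : (q < M)%N by apply: leq_ltn_trans (leq_addl _ _) (Cq kn).
have D0 : 0 < (M - q)%:R :> R by rewrite ltr0n subn_gt0.
have DE : (M - q)%:R = M%:R - q%:R :> R by rewrite natrB // ltnW.
have ex_le : ex <= (s ^+ 80)^-1.
  apply: le_trans (expR_cutoff kn); rewrite ler_expR lerN2 ler_wpM2r ?(ltW N0) //.
  have cut0 j : (j.+1 < n)%N -> 0 <= cutoff R n j.+1.
    by move=> jn; apply: le_trans (cutoff_ge jn); rewrite invr_ge0.
  have /andP[_ /ltW h] := cutoff_cells_itv [ffun=> Ordinal M0] cut0 kn.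
  apply: le_trans h _; rewrite ler_wpM2l // lef_pV2 ?posrE //.
  by rewrite ler_nat leq_subr.
have ex0 : 0 <= ex by exact: expR_ge0.
(* The shortfall splits exactly into the share [q / M] of cells already passed, the mass lost to
   truncation, and one cell of rounding. *)
have -> : N.+1%:R^-1 - (M - q)%:R / N.+1%:R * (1 - N.+1%:R / (M - q)%:R - ex) / M%:R =
    N.+1%:R^-1 * (q%:R / M%:R + (M - q)%:R / M%:R * ex) + M%:R^-1.
  rewrite DE; field; rewrite -DE !gt_eqF //=.
rewrite /beta lerD2r -mulrDl mulrC ler_pM ?invr_ge0 //.
- by rewrite addr_ge0 // ?mulr_ge0 ?divr_ge0.
- rewrite lerD ?q_le // (le_trans _ ex_le) // ler_piMl // ler_pdivrMr // mul1r.
  by rewrite ler_nat leq_subr.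
by rewrite lef_pV2 ?posrE // ler_nat.
Qed.

(** The three parts of [beta] contribute at most [1 / n], [4 / n] and [1 / n]. *)
Let sum_beta : \sum_(i < n.-1) beta i <= 6 / n%:R.
Proof.
rewrite !big_split /= -!mulr_sumr -/H sumr_const card_ord -mulr_natl.
have h1 : n.-1%:R / M%:R <= n%:R^-1 :> R.
  apply: le_trans (le_trans n_invM inv_n2).
  by rewrite ler_wpM2r ?invr_ge0 ?(ltW M0') // ler_nat leq_pred.
have s80 : 0 < s ^+ 80 by rewrite exprn_gt0.
have h2 : (s ^+ 80)^-1 * H <= 4 / n%:R.
  rewrite mulrC ler_pdivrMr //; apply: le_trans sum_trials_inv_le _.
  by rewrite mulrAC.
have h3 : delta * H <= n%:R^-1.
  apply: (le_trans (ler_wpM2l delta0 sum_trials_inv_le)).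
  rewrite /delta (_ : _ * _ / _ * _ = 20 * s ^+ 320 / n%:R / n%:R).
    by rewrite ler_piMl ?invr_ge0 ?(ltW n0) // small //; lra.
  by rewrite (_ : 320 = 240 + 80)%N // exprD; ring.
lra.
Qed.

Let fast_gap i : (i < n.-1)%N ->
  (1 - (J i)%:R / M%:R) ^+ trials n i <= expR (- s ^+ 160).
Proof.
move=> i_n; have N0 : 0 < (trials n i)%:R :> R by rewrite ltr0n trials_gt0 -?ltn_predRL.
apply: (@le_trans _ _ (expR (- ((J i)%:R / M%:R)) ^+ trials n i)).
  rewrite lerXn2r ?nnegrE ?expR_ge0 ?expR_ge1Dx //.
  by rewrite subr_ge0 ler_pdivrMr // mul1r ler_nat J_le.
rewrite -expRM_natr ler_expR mulNr lerN2 mulrAC ler_pdivlMr //.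
by have /andP[h _] := J_itv i; rewrite ler_pdivrMr // [s ^+ 160 * _]mulrC in h *.
Qed.

(** The threshold [3/2] leaves [1/2] of the allowed [2 * s^64 / n] for the passage from the grid to
    the labels. *)
Lemma card_bad_le :
  #|@bad_grids R n M (cutoff_cells R n M) (3 / 2 * s ^+ 64 / n%:R)|%:R <=
  #|{: grid}|%:R * expR (- s ^+ 120).
Proof.
have cut0 j : (j.+1 < n)%N -> 0 <= cutoff R n j.+1.
  by move=> jn; apply: le_trans (cutoff_ge jn); rewrite invr_ge0.
have Cb j : (j.+1 < n)%N -> (cutoff_cells R n M j)%:R / M%:R <= cutoff R n j.+1.
  by move=> jn; case/andP: (cutoff_cells_itv [ffun=> Ordinal M0] cut0 jn).
have mub j : (j.+1 < n)%N -> (trials n j).+1%:R^-1 <= cutoff R n j.+1.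
  move=> jn; apply: le_trans (cutoff_ge jn).
  by rewrite lef_pV2 ?posrE ?ltr0n ?trials_gt0 // ler_nat.
have beta0 j : 0 <= beta j.
  have i0 (a : nat) : 0 <= a%:R^-1 :> R by rewrite invr_ge0.
  apply: addr_ge0 (i0 M); apply: addr_ge0; first exact: mulr_ge0 delta0 (i0 _).
  by apply: mulr_ge0 (i0 _); rewrite invr_ge0 exprn_ge0 // ltW.
have th0 : 0 <= n%:R * s ^+ 60 by rewrite mulr_ge0 ?exprn_ge0 // ltW.
have := @card_bad_grids R n M (cutoff_cells R n M) J (fun j => cutoff R n j.+1) beta
  (n%:R * s ^+ 60) (3 / 2 * s ^+ 64 / n%:R) _ _ _ (ltnW n1) th0 (expR_ge0 _)
  Cq J_le Cb mub beta0 beta_ge (sum_cutoff_sqr s1 n1 ln_n) sum_beta fast_gap.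
move/le_trans; apply; rewrite ler_wpM2l // (_ : n%:R ^+ 2 = expR (2 * s ^+ 80)); last first.
  by rewrite n_exp expRM_natl.
set x := (X in 2 * expR X + _).
have x_le : x <= - s ^+ 124.
  (* Deviation, variance and bias terms in this order. As [12 * 176^2 + 6] is below [s^2 / 2] for
     [s >= 1000], the last two use up less than the spare half of [s^124]. *)
  have -> : x = - (3 / 2 * s ^+ 124) + 12 * 176 ^+ 2 * s ^+ 122 + 6 * s ^+ 60.
    rewrite /x (_ : 124 = 60 + 64)%N // (_ : 122 = 60 + 60 + 2)%N // !exprD.
    by field; rewrite gt_eqF.
  have h1 : s ^+ 60 <= s ^+ 122 by exact: s_pow.
  move: (exprn_ge0 122 (ltW s0)) h1 (s_pow_ge 122) (s_pow_ge 123).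
  move: (s ^+ 60) (s ^+ 122) (s ^+ 123) (s ^+ 124) => a b c d.
  lra.
have y_le : - s ^+ 160 <= - s ^+ 124 by rewrite lerN2; exact: s_pow.
have z_le : 2 * expR x + expR (- s ^+ 160) <= expR 2 * expR (- s ^+ 124).
  have a1 : expR x <= expR (- s ^+ 124) by rewrite ler_expR.
  have a2 : expR (- s ^+ 160) <= expR (- s ^+ 124) by rewrite ler_expR.
  have a3 : 3 <= expR 2 :> R by apply: le_trans (expR_ge1Dx _); lra.
  have a4 := expR_gt0 (- s ^+ 124).
  nra.
apply: le_trans (ler_wpM2l (expR_ge0 _) z_le) _.
rewrite -!expRD ler_expR.
have h1 : s ^+ 80 <= s ^+ 123 by exact: s_pow.
have h2 : s ^+ 120 <= s ^+ 123 by exact: s_pow.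
have h4 : 1 <= s ^+ 123 by exact: exprn_ege1.
move: h1 h2 h4 (s_pow_ge 123).
move: (s ^+ 80) (s ^+ 120) (s ^+ 123) (s ^+ 124) => a b c d.
  lra.
Qed.

(** Since [M >= n^3], the left side is at most [3 / n^2]. *)
Lemma grid_error k : (k < n)%N -> 3 * k%:R / M%:R <= 2^-1 * s ^+ 64 / n%:R.
Proof.
move=> kn; apply: (@le_trans _ _ (3 * (n%:R / M%:R))).
  by rewrite -mulrA ler_pM2l // ler_wpM2r ?invr_ge0 ?(ltW M0') // ler_nat ltnW.
have h : 1000 <= s ^+ 64.
  move: (s_pow_ge 63) (exprn_ege1 63 s1).
  by move: (s ^+ 63) (s ^+ 64) => a b; lra.
have : 1000 / n%:R <= s ^+ 64 / n%:R by rewrite ler_wpM2r // invr_ge0 ltW.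
have i0 : 0 < n%:R^-1 :> R by rewrite invr_gt0.
by rewrite -mulrA; move: n_invM inv_n2; lra.
Qed.

End Constants.

(** * Threshold, grid size and conclusion *)

Lemma sqrt_pow80 (R : realType) (s : R) : 0 <= s -> Num.sqrt (s ^+ 80) = s ^+ 40.
Proof. by move=> s0; rewrite (exprM s 40 2) sqrtr_sqr ger0_norm ?exprn_ge0. Qed.

Theorem theorem4p7 (R : realType) :
  exists N : nat, forall n : nat, (N <= n)%N ->
  forall (d : measure_display) (Omega : measurableType d)
    (P : probability Omega R) (lam : {set 'I_n} -> {RV P >-> R}),
  uniform_labels lam ->
  ((1 - 2 * n%:R `^ (- Num.sqrt (ln n%:R)))%:E <=
   P [set w | forall (v : 'I_n) (k : nat), (1 <= k <= n - 1)%N ->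
        (`|Yhat (complete_graph n) (fun e => lam e w) v k
          - \sum_(1 <= i < k.+1) ((i * (n - i))%:R + 1)^-1|
        <= 2 * (ln n%:R) `^ (8%:R / 10%:R) / n%:R)%R]%classic)%E.
Proof.
have [x x_ge] : exists x : R, 1000 <= x by exists 1000.
have x0 : 0 <= x := le_trans (ler0n _ _) x_ge.
(* This threshold forces [log n >= x^80], hence [s >= 1000] below; the second successor also ensures
   [n > 1]. *)
exists (Num.trunc (expR (x ^+ 80))).+2 => n n_large d Omega P lam lamU.
have n1 : (1 < n)%N by apply: leq_trans n_large.
have n0 : 0 < n%:R :> R by rewrite ltr0n ltnW.
have L_ge : x ^+ 80 <= ln n%:R :> R.
  rewrite -[leLHS]expRK ler_ln ?posrE ?expR_gt0 //.
  have /andP[_ /ltW h] := truncn_itv (expR_ge0 (x ^+ 80)).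
  by apply: le_trans h _; rewrite ler_nat ltnW.
have L0 : 0 <= ln n%:R :> R by apply: le_trans L_ge; exact: exprn_ge0.
pose s : R := ln n%:R `^ (80%:R^-1).
have s0 : 0 <= s by exact: powR_ge0.
have ln_n : ln n%:R = s ^+ 80.
  by rewrite -powR_mulrn // -powRrM mulVf ?powRr1 // pnatr_eq0.
have s_ge : 1000 <= s.
  apply: (le_trans x_ge); rewrite leNgt; apply/negP => lt; move: L_ge; rewrite ln_n leNgt => /negP[].
  by rewrite ltrXn2r // nnegrE.
have -> : (ln n%:R) `^ (8%:R / 10%:R) = s ^+ 64 :> R.
  rewrite ln_n -powR_mulrn // -powRrM -powR_mulrn //; congr (_ `^ _); lra.
(* The exponent is [s^40 * s^80], the square root of [log n] times [log n]. *)
have -> : n%:R `^ (- Num.sqrt (ln n%:R)) = expR (- s ^+ 120) :> R.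
  rewrite ln_n sqrt_pow80 // /powR gt_eqF // ln_n mulNr -exprD.
  by congr (expR (- (s ^+ _))).
set e := expR _; have e0 : 0 < e by exact: expR_gt0.
pose K := #|{set 'I_n}|.
(* The cubic term controls the rounding errors; the other makes the share of grids with two labels
   in one cell at most [e]. *)
pose M := (Num.trunc (n%:R ^+ 3 + K%:R ^+ 2 / e : R)).+1.
have M_gt : n%:R ^+ 3 + K%:R ^+ 2 / e <= M%:R.
  by rewrite ltW // truncnS_gt.
have M0 : (0 < M)%N by [].
have M0' : 0 < M%:R :> R by rewrite ltr0n.
have K0 : 0 <= K%:R ^+ 2 / e by rewrite divr_ge0 ?exprn_ge0 // ltW.
have M3 : n%:R ^+ 3 <= M%:R :> R by apply: le_trans M_gt; rewrite lerDl.
have KM : K%:R ^+ 2 / M%:R <= e.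
  rewrite ler_pdivrMr // mulrC -ler_pdivrMr //; apply: le_trans M_gt.
  by rewrite lerDr exprn_ge0.
pose t := 3 / 2 * s ^+ 64 / n%:R.
pose bad := @bad_grids R n M (cutoff_cells R n M) t.
pose noninj := [set c : {ffun {set 'I_n} -> 'I_M} | ~~ injectiveb c].
pose T : R := #|{: {ffun {set 'I_n} -> 'I_M}}|%:R.
have T0 : 0 < T by rewrite ltr0n; apply/card_gt0P; exists [ffun=> Ordinal M0].
have bad_le : #|bad|%:R <= T * e by exact: card_bad_le.
have noninj_le : #|noninj|%:R <= T * e.
  by apply: le_trans (card_noninjective R n M0) _; rewrite ler_pM2l.
have cut0 j : (j.+1 < n)%N -> 0 <= cutoff R n j.+1.
  by move=> jn; apply: le_trans (cutoff_ge s_ge ln_n jn); rewrite invr_ge0.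
(* Excluding large deviations and excluding collisions each cost at most [e], whence the factor [2]
   in the failure probability. *)
apply: le_trans (prob_ge_grid lamU (G := ~: (bad :|: noninj)) M0 _ _); last first.
- move=> c; rewrite finset.in_setC finset.in_setU negb_or => /andP[cbad].
  rewrite inE negbK => /injectiveP cinj w wc v k /andP[k1 kn].
  have {}kn : (k < n)%N by rewrite (leq_ltn_trans kn) // subn1 ltn_predL ltnW.
  apply: le_trans (cell_Yhat wc cinj cut0 v kn) _.
  have W : `|total_deviation R v (cutoff_cells R n M) c k| <= t.
    rewrite leNgt; apply: contra cbad => tW; rewrite inE; apply/existsP; exists v.
    by apply/existsP; exists (Ordinal kn).
  have -> : 2 * s ^+ 64 / n%:R = t + 2^-1 * s ^+ 64 / n%:R by rewrite /t; lra.
  by apply: lerD W _; apply: grid_error.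
- exact: measurable_good.
rewrite lee_fin ler_pdivlMr //.
have cU : (#|bad :|: noninj| <= #|bad| + #|noninj|)%N by exact: leq_card_setU.
have : T = #|bad :|: noninj|%:R + #|~: (bad :|: noninj)|%:R by rewrite -natrD cardsC.
have : #|bad :|: noninj|%:R <= #|bad|%:R + #|noninj|%:R :> R by rewrite -natrD ler_nat.
rewrite -/T; nra.
Qed.
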